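(* Let $\Lambda$ be an artin algebra and let $\mathcal{C}$ be an $n\mathbb{Z}$-cluster tilting subcategory of $\mathrm{mod}\text{-}\Lambda$. Then $\mathcal{C}$ is an $n\mathbb{Z}$-G-cluster tilting ($n\mathbb{Z}$-Gorenstein cluster tilting) subcategory of $\mathrm{mod}\text{-}\Lambda$ if and only if $\Lambda$ is a Gorenstein algebra.
   Context: $n$ is a positive integer, $\Lambda$ is an artin algebra over a commutative artinian ring, $\mathrm{mod}\text{-}\Lambda$ is the category of finitely generated right $\Lambda$-modules. $\Lambda$ is (Iwanaga-)Gorenstein if it has finite injective dimension both as a right and as a left module over itself. $\Omega^k$ and $\Omega^{-k}$ denote $k$-th syzygies and cosyzygies. A full subcategory $\mathcal{C}$ of $\mathrm{mod}\text{-}\Lambda$ is $n$-cluster tilting if it is functorially finite and $\mathcal{C}=\{X\mid \mathrm{Ext}^i_\Lambda(\mathcal{C},X)=0 \text{ for all } 0<i<n\}=\{X\mid \mathrm{Ext}^i_\Lambda(X,\mathcal{C})=0\text{ for all } 0<i<n\}$. It is $n\mathbb{Z}$-cluster tilting if moreover $\mathrm{Ext}^i_\Lambda(\mathcal{C},\mathcal{C})=0$ for all $i>0$ with $i\notin n\mathbb{Z}$ (equivalently $\Omega^n(\mathcal{C})\subseteq\mathcal{C}$; equivalently $\Omega^{-n}(\mathcal{C})\subseteq\mathcal{C}$). An acyclic complex $\mathbf{P}:\cdots\to P^{-1}\to P^0\to P^1\to\cdots$ of finitely generated projective $\Lambda$-modules, with $Z^j=\mathrm{Ker}(P^j\to P^{j+1})$,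 is called $n\mathbb{Z}$-totally acyclic if (i) for every $i\in\mathbb{Z}$ and every projective $\Lambda$-module $Q$, applying $\mathrm{Hom}_\Lambda(-,Q)$ to the exact sequence $0\to Z^{in}\to P^{in}\to\cdots\to P^{(i+1)n-1}\to Z^{(i+1)n}\to 0$ gives an acyclic complex, and (ii) $Z^{in}\in\mathcal{C}$ for all $i\in\mathbb{Z}$. A module $G\in\mathcal{C}$ is $n\mathbb{Z}$-Gorenstein projective if $G\cong Z^{in}$ for some $i$ and some $n\mathbb{Z}$-totally acyclic complex; $n\mathbb{Z}\text{-}\mathrm{Gprj}\text{-}\mathcal{C}$ is the full subcategory of these modules. Dually (using acyclic complexes of finitely generated injectives and the functors $\mathrm{Hom}_\Lambda(I,-)$ with $I$ injective) one defines $n\mathbb{Z}$-Gorenstein injective modules in $\mathcal{C}$ and the full subcategory $n\mathbb{Z}\text{-}\mathrm{Ginj}\text{-}\mathcal{C}$. An $n\mathbb{Z}$-cluster tilting subcategory $\mathcal{C}$ is $n\mathbb{Z}$-Gorenstein projective cluster tilting if for every $C\in\mathcal{C}$ there is an integer $i\ge 0$ with $\Omega^{in}(C)\in n\mathbb{Z}\text{-}\mathrm{Gprj}\text{-}\mathcal{C}$; it is $n\mathbb{Z}$-Gorenstein injective cluster tilting if for every $C\in\mathcal{C}$ there is an integer $i\ge0$ with $\Omega^{-in}(C)\in n\mathbb{Z}\text{-}\mathrm{Ginj}\text{-}\mathcal{C}$; it is $n\mathbb{Z}$-Gorenstein cluster tilting ($n\mathbb{Z}$-G-cluster tilting) if it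 is both. *)

(* Defs.v *)
From HB Require Import structures.
From mathcomp Require Import all_boot all_order all_algebra.

Set Implicit Arguments.
Unset Strict Implicit.
Unset Printing Implicit Defensive.

Import GRing.Theory.
Local Open Scope ring_scope.

(* Everything is developed for left modules over an arbitrary ring [A]; right
   modules over [L] are the left modules over the converse ring [L^c].  The
   rings are [pzRingType]s, so that the zero ring is not excluded. *)

Section Modules.
Variable A : pzRingType.
Implicit Types M N K P I X Y : lmodType A.

Definition fgmod M : Prop :=
  exists (m : nat) (g : 'I_m -> M),
    forall x : M, exists c : 'I_m -> A, x = \sum_(i < m) c i *: g i.

Definition surjective_map (S T : Type) (f : S -> T) : Prop :=
  forall y, exists x, f x = y.

Definition isomorphic M N : Prop := exists f : {linear M -> N}, bijective f.

Definition exact_at M N K (f : {linear M -> N}) (g : {linear N -> K}) : Prop :=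
  forall y : N, g y = 0 <-> exists x : M, f x = y.

Definition trivial_module M : Prop := forall x : M, x = 0.

Definition projective P : Prop :=
  forall M N (f : {linear M -> N}) (g : {linear P -> N}),
    surjective_map f -> exists h : {linear P -> M}, forall x, f (h x) = g x.

Definition injective_module I : Prop :=
  forall M N (f : {linear M -> N}) (g : {linear M -> I}),
    injective f -> exists h : {linear N -> I}, forall x, h (f x) = g x.

End Modules.

Section Kernel.
Variables (A : pzRingType) (M N : lmodType A) (f : {linear M -> N}).

Definition kerp : {pred M} := fun x => f x == 0.

Fact kerp_submod_closed : GRing.submod_closed kerp.
Proof.
split=> [|a x y]; first by rewrite unfold_in raddf0.
by rewrite !unfold_in linearP => /eqP-> /eqP->; rewrite scaler0 addr0.
Qed.
HB.instance Definition _ :=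
  GRing.isSubmodClosed.Build A M kerp kerp_submod_closed.

Definition ker : Type := {x : M | x \in kerp}.
HB.instance Definition _ := SubType.on ker.
HB.instance Definition _ := Choice.on ker.
HB.instance Definition _ := [SubChoice_isSubLmodule of ker by <:].

Definition ker_incl (z : ker) : M := val z.
Fact ker_incl_is_linear : linear ker_incl. Proof. by []. Qed.
HB.instance Definition _ :=
  GRing.isLinear.Build A ker M _ ker_incl ker_incl_is_linear.

End Kernel.

Section Corestriction.
Variables (A : pzRingType) (M N K : lmodType A).
Variables (f : {linear M -> N}) (g : {linear N -> K}).
Hypothesis gf0 : forall x, g (f x) = 0.

Fact ker_corestr_subproof x : f x \in kerp g.
Proof. by rewrite unfold_in gf0. Qed.

Definition ker_corestr (x : M) : ker g := Sub (f x) (ker_corestr_subproof x).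
Fact ker_corestr_is_linear : linear ker_corestr.
Proof. by move=> a x y; apply: val_inj; rewrite /= linearP. Qed.
HB.instance Definition _ :=
  GRing.isLinear.Build A M (ker g) _ ker_corestr ker_corestr_is_linear.

End Corestriction.

Section Homological.
Variable A : pzRingType.
Implicit Types M N K P I J Q W X Y Z : lmodType A.

(* ... -> P 1 -> P 0 -> X -> 0 *)
Record proj_resolution X := ProjResolution {
  pr_obj : nat -> lmodType A;
  pr_diff : forall k, {linear pr_obj k.+1 -> pr_obj k};
  pr_aug : {linear pr_obj 0 -> X};
  pr_projective : forall k, projective (pr_obj k);
  pr_aug_surj : surjective_map pr_aug;
  pr_exact0 : exact_at (pr_diff 0) pr_aug;
  pr_exact : forall k, exact_at (pr_diff k.+1) (pr_diff k)
}.

(* Ext^k(X, Y) = 0: the k-th cohomology of Hom(P, Y) vanishes, P being a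
   projective resolution of X (the choice of which is immaterial). *)
Definition Ext_vanishes (k : nat) X Y : Prop :=
  exists R : proj_resolution X,
    forall f : {linear pr_obj R k -> Y},
      (forall x, f (pr_diff R k x) = 0) ->
      match k return {linear pr_obj R k -> Y} -> Prop with
      | 0 => fun f => forall x, f x = 0
      | j.+1 => fun f =>
          exists g : {linear pr_obj R j -> Y}, forall x, f x = g (pr_diff R j x)
      end f.

(* 0 -> X -> I 0 -> I 1 -> ... *)
Record inj_resolution X := InjResolution {
  ir_obj : nat -> lmodType A;
  ir_diff : forall k, {linear ir_obj k -> ir_obj k.+1};
  ir_coaug : {linear X -> ir_obj 0};
  ir_injective : forall k, injective_module (ir_obj k);
  ir_coaug_inj : injective ir_coaug;
  ir_exact0 : exact_at ir_coaug (ir_diff 0);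
  ir_exact : forall k, exact_at (ir_diff k) (ir_diff k.+1)
}.

Definition finite_injective_dimension X : Prop :=
  exists (d : nat) (R : inj_resolution X),
    forall k, (d < k)%N -> trivial_module (ir_obj R k).

Definition essential_epi M N (f : {linear M -> N}) : Prop :=
  surjective_map f /\
  forall X (g : {linear X -> M}),
    surjective_map (fun x => f (g x)) -> surjective_map g.

Definition essential_mono M N (f : {linear M -> N}) : Prop :=
  injective f /\
  forall X (g : {linear N -> X}), injective (fun x => g (f x)) -> injective g.

Definition projective_cover P X (p : {linear P -> X}) : Prop :=
  [/\ fgmod P, projective P & essential_epi p].

Definition injective_envelope X I (j : {linear X -> I}) : Prop :=
  [/\ fgmod I, injective_module I & essential_mono j].

(* K is isomorphic to Omega^k X, formed with projective covers *)
Fixpoint is_syzygy (k : nat) X K : Prop :=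
  match k with
  | 0 => isomorphic K X
  | j.+1 => exists Y P (p : {linear P -> Y}),
      [/\ is_syzygy j X Y, projective_cover p & isomorphic K (ker p)]
  end.

(* K is isomorphic to Omega^-k X, formed with injective envelopes; the
   surjection c exhibits K as the cokernel of j *)
Fixpoint is_cosyzygy (k : nat) X K : Prop :=
  match k with
  | 0 => isomorphic K X
  | j.+1 => exists Y I (i : {linear Y -> I}) (c : {linear I -> K}),
      [/\ is_cosyzygy j X Y, injective_envelope i,
          surjective_map c & exact_at i c]
  end.

(* A nonempty string of composable maps X -> X1 -> ... -> Xm *)
Inductive string (X : lmodType A) : Type :=
  | Last (Y : lmodType A) (f : {linear X -> Y})
  | Cons (Y : lmodType A) (f : {linear X -> Y}) (s : string Y).

(* Hom(Z, Q) -> Hom(Y, Q) -> Hom(X, Q) is exact at Hom(Y, Q) *)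
Definition contra_hom_exact Q X Y Z
    (f : {linear X -> Y}) (g : {linear Y -> Z}) : Prop :=
  forall h : {linear Y -> Q},
    (forall x, h (f x) = 0) <->
    exists u : {linear Z -> Q}, forall y, h y = u (g y).

(* Hom(J, X) -> Hom(J, Y) -> Hom(J, Z) is exact at Hom(J, Y) *)
Definition co_hom_exact J X Y Z
    (f : {linear X -> Y}) (g : {linear Y -> Z}) : Prop :=
  forall h : {linear J -> Y},
    (forall x, g (h x) = 0) <->
    exists u : {linear J -> X}, forall x, h x = f (u x).

Fixpoint contra_hom_acyclic_from Q W X (f : {linear W -> X}) (s : string X) :
    Prop :=
  match s with
  | Last Y g => contra_hom_exact Q f g /\
      (forall h : {linear Y -> Q},
         (forall x, h (g x) = 0) -> forall y, h y = 0)
  | Cons Y g s' => contra_hom_exact Q f g /\ contra_hom_acyclic_from Q g s'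
  end.

(* For a string W -> X1 -> ... -> Xm with m > 1, the complex
   0 -> Hom(Xm, Q) -> ... -> Hom(X1, Q) -> Hom(W, Q) -> 0 is acyclic. *)
Definition contra_hom_acyclic Q W X (f : {linear W -> X}) (s : string X) :
    Prop :=
  (forall h : {linear W -> Q},
     exists u : {linear X -> Q}, forall w, h w = u (f w)) /\
  contra_hom_acyclic_from Q f s.

Fixpoint co_hom_acyclic_from J W X (f : {linear W -> X}) (s : string X) :
    Prop :=
  match s with
  | Last Y g => co_hom_exact J f g /\
      (forall h : {linear J -> Y},
         exists u : {linear J -> X}, forall x, h x = g (u x))
  | Cons Y g s' => co_hom_exact J f g /\ co_hom_acyclic_from J g s'
  end.

(* For a string W -> X1 -> ... -> Xm with m > 1, the complex
   0 -> Hom(J, W) -> Hom(J, X1) -> ... -> Hom(J, Xm) -> 0 is acyclic. *)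
Definition co_hom_acyclic J W X (f : {linear W -> X}) (s : string X) : Prop :=
  (forall h : {linear J -> W},
     (forall x, f (h x) = 0) -> forall x, h x = 0) /\
  co_hom_acyclic_from J f s.

Record complex := Complex {
  cx_obj :> int -> lmodType A;
  cx_diff : forall i, {linear cx_obj i -> cx_obj (i + 1)};
  cx_diffK : forall i x, cx_diff (i + 1) (cx_diff i x) = 0
}.

Definition acyclic (P : complex) : Prop :=
  forall i, exact_at (cx_diff P i) (cx_diff P (i + 1)).

(* Z^i = Ker (P^i -> P^(i+1)) *)
Definition cycles (P : complex) (i : int) : lmodType A := ker (cx_diff P i).

Definition cycles_incl (P : complex) i : {linear cycles P i -> P i} :=
  @ker_incl A _ _ (cx_diff P i).

Definition to_cycles (P : complex) i : {linear P i -> cycles P (i + 1)} :=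
  ker_corestr (@cx_diffK P i).

(* P^i -> P^(i+1) -> ... -> P^(i+k) -> Z^(i+k+1) *)
Fixpoint segment_tail (P : complex) (k : nat) (i : int) : string (P i) :=
  match k with
  | 0 => Last (to_cycles P i)
  | j.+1 => Cons (cx_diff P i) (segment_tail P j (i + 1))
  end.

End Homological.

Section ClusterTilting.
Variable A : pzRingType.

(* A full subcategory of the finitely generated A-modules is given by the class
   of its objects. *)
Variables (n : nat) (C : lmodType A -> Prop).

Definition contravariantly_finite : Prop :=
  forall X, fgmod X ->
    exists (T : lmodType A) (f : {linear T -> X}), C T /\
      forall (T' : lmodType A) (g : {linear T' -> X}), C T' ->
        exists h : {linear T' -> T}, forall x, g x = f (h x).

Definition covariantly_finite : Prop :=
  forall X, fgmod X ->
    exists (T : lmodType A) (f : {linear X -> T}), C T /\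
      forall (T' : lmodType A) (g : {linear X -> T'}), C T' ->
        exists h : {linear T -> T'}, forall x, g x = h (f x).

Definition functorially_finite : Prop :=
  contravariantly_finite /\ covariantly_finite.

Definition cluster_tilting : Prop :=
  [/\ functorially_finite,
      forall X, C X <-> fgmod X /\
        forall T, C T -> forall i, (0 < i < n)%N -> Ext_vanishes i T X
    & forall X, C X <-> fgmod X /\
        forall T, C T -> forall i, (0 < i < n)%N -> Ext_vanishes i X T].

Definition nZ_cluster_tilting : Prop :=
  cluster_tilting /\
  forall X Y, C X -> C Y ->
    forall i, (0 < i)%N -> ~~ (n %| i)%N -> Ext_vanishes i X Y.

(* The sequence to which Hom is applied is
   0 -> Z^(in) -> P^(in) -> ... -> P^((i+1)n-1) -> Z^((i+1)n) -> 0.  The test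
   modules Q and J are taken in the category of finitely generated modules;
   over an artin algebra this is no restriction: Hom out of a finitely
   generated module commutes with direct sums, and every injective module is a
   direct sum of finitely generated ones. *)
Definition nZ_totally_acyclic (P : complex A) : Prop :=
  [/\ acyclic P,
      forall i, fgmod (P i) /\ projective (P i),
      forall (i : int) (Q : lmodType A), fgmod Q -> projective Q ->
        contra_hom_acyclic Q (cycles_incl P (i * n%:Z))
          (segment_tail P n.-1 (i * n%:Z))
    & forall i : int, C (cycles P (i * n%:Z))].

Definition nZ_totally_acyclic_inj (I : complex A) : Prop :=
  [/\ acyclic I,
      forall i, fgmod (I i) /\ injective_module (I i),
      forall (i : int) (J : lmodType A), fgmod J -> injective_module J ->
        co_hom_acyclic J (cycles_incl I (i * n%:Z))
          (segment_tail I n.-1 (i * n%:Z))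
    & forall i : int, C (cycles I (i * n%:Z))].

Definition nZ_Gprj (G : lmodType A) : Prop :=
  C G /\ exists (P : complex A) (i : int),
    nZ_totally_acyclic P /\ isomorphic G (cycles P (i * n%:Z)).

Definition nZ_Ginj (G : lmodType A) : Prop :=
  C G /\ exists (I : complex A) (i : int),
    nZ_totally_acyclic_inj I /\ isomorphic G (cycles I (i * n%:Z)).

Definition nZ_Gorenstein_projective_cluster_tilting : Prop :=
  nZ_cluster_tilting /\
  forall X, C X -> exists (i : nat) (K : lmodType A),
    is_syzygy (i * n) X K /\ nZ_Gprj K.

Definition nZ_Gorenstein_injective_cluster_tilting : Prop :=
  nZ_cluster_tilting /\
  forall X, C X -> exists (i : nat) (K : lmodType A),
    is_cosyzygy (i * n) X K /\ nZ_Ginj K.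

Definition nZ_Gorenstein_cluster_tilting : Prop :=
  nZ_Gorenstein_projective_cluster_tilting /\
  nZ_Gorenstein_injective_cluster_tilting.

End ClusterTilting.

Definition is_ideal (R : comPzRingType) (I : R -> Prop) : Prop :=
  [/\ I 0, forall x y, I x -> I y -> I (x + y)
    & forall a x, I x -> I (a * x)].

Definition artinian (R : comPzRingType) : Prop :=
  forall I : nat -> R -> Prop,
    (forall k, is_ideal (I k)) ->
    (forall k x, I k.+1 x -> I k x) ->
    exists m, forall k, (m <= k)%N -> forall x, I m x -> I k x.

(* The R-algebra structure on L is its structure morphism [phi]; [algType R]
   would exclude L = 0. *)
Definition artin_algebra (R : comPzRingType) (L : pzRingType)
    (phi : {rmorphism R -> L}) : Prop :=
  [/\ artinian R,
      forall (r : R) (x : L), phi r * x = x * phi r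
    & exists (m : nat) (g : 'I_m -> L),
        forall x : L, exists c : 'I_m -> R, x = \sum_(i < m) phi (c i) * g i].

(* [L^o] is L as a left module over itself, [(L^c)^o] is L as a right one. *)
Definition Gorenstein (L : pzRingType) : Prop :=
  @finite_injective_dimension L^c (L^c)^o /\
  @finite_injective_dimension L L^o.

(* Main.v *)
From HB Require Import structures.
From mathcomp Require Import all_boot all_order all_algebra.
From mathcomp Require Import boolp classical_sets.
Require Import Defs.

(* Matlis duality: an artinian ring R has finite length. Call an R-module thin if its socle is multiplicity free; if E is thin then
   length Hom(N, E) <= length N, so E = Hom(R, E) has length at most that of R.
   A thin module of maximal length has no proper essential extension and misses
   no simple module: it is the minimal injective cogenerator, and
   D = Hom_R(-, E) is a duality between right and left modules.

   Vanishing of Ext^(k+1)(X, Y) is expressed by syzygies of X, and D transports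
   it to the other side: Ext(X, D Y) = 0 iff Ext(Y, D X) = 0. Hence the class of
   the Y with D Y in C is n Z-cluster tilting for left modules, and everything
   on injective objects of C follows from its projective counterpart.

   If C is Gorenstein projective cluster tilting, every C-object has bounded
   Ext into the regular module, hence so does every module, by finite
   C-resolutions, and uniformly so since there are finitely many simple
   modules; thus cosyzygies of the regular module end up injective.
   Conversely, over a Gorenstein algebra the modules G with Ext^(>0)(G, A) = 0
   embed in projectives with cokernel of the same kind, because injectives
   have finite projective dimension; far syzygies of the objects of C are such
   modules, and both directions of a complete resolution starting from one stay
   in C every n steps by dimension shifting. *)

Set Implicit Arguments.
Unset Strict Implicit.
Unset Printing Implicit Defensive.

Import GRing.Theory.
Local Open Scope ring_scope.

(** Only the vanishing of Ext matters, so no Ext groups are built: the needed pieces of the long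
    exact sequences are implications between lifting and extension problems on one projective
    presentation, and independence of the presentation is handled by stable retracts. Finite
    generation is carried along because it gives finitely generated syzygies and makes evaluation
    into the double dual bijective.

    The two halves of the Gorenstein condition act differently in the converse. Finite injective
    dimension of the regular module on the side of C makes far syzygies orthogonal to projectives.
    On the other side it turns, through D, into finite projective dimension of the injectives on the
    side of C, which is what lets these syzygies be continued to the right.

    In the direct implication each object of C comes with its own bound, while injective dimension
    asks for a single one: hence the detour through simple modules. *)

Section Basics.
Variable A : pzRingType.
Implicit Types M N K X Y Z W : lmodType A.

Definition mklin M N (f : M -> N) (H : linear f) : {linear M -> N} :=
  HB.pack f (GRing.isLinear.Build A M N _ f H).

Definition submod M (U : M -> Prop) : Prop :=
  U 0 /\ forall a x y, U x -> U y -> U (a *: x + y).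

Lemma submodD M (U : M -> Prop) x y : submod U -> U x -> U y -> U (x + y).
Proof. by move=> [_ h] ux uy; rewrite -[x]scale1r; apply: h. Qed.

Lemma submodZ M (U : M -> Prop) a x : submod U -> U x -> U (a *: x).
Proof. by move=> [h0 h] ux; rewrite -[a *: x]addr0; apply: h. Qed.

Lemma submodB M (U : M -> Prop) x y : submod U -> U x -> U y -> U (x - y).
Proof. by move=> [_ h] ux uy; rewrite addrC -scaleN1r; apply: h. Qed.

Lemma submod0 M : submod (fun x : M => x = 0).
Proof. by split=> // a _ _ -> ->; rewrite scaler0 addr0. Qed.

Lemma submod_adjoin M (W : M -> Prop) z : submod W ->
  submod (fun x => exists w a, W w /\ x = w + a *: z).
Proof.
move=> sW; split=> [|b _ _ [w [a [Ww ->]]] [w' [a' [Ww' ->]]]].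
  by exists 0, 0; rewrite scale0r addr0; split=> //; apply: sW.1.
exists (b *: w + w'), (b * a + a'); split; first exact: sW.2.
by rewrite scalerDr scalerDl addrACA scalerA.
Qed.

Fact scaler_regular_linear M (x : M) : linear (fun a : A^o => (a : A) *: x).
Proof. by move=> a b c; rewrite scalerDl scalerA. Qed.

Definition scaler_map M (x : M) : {linear A^o -> M} :=
    mklin (scaler_regular_linear x).

Lemma factor_inj K M W (i : {linear K -> M}) (f : {linear W -> M}) :
  injective i -> (forall w, exists k, i k = f w) ->
  exists g : {linear W -> K}, forall w, i (g w) = f w.
Proof.
move=> ii /choice[g gP].
have lg : linear g by move=> a x y; apply: ii; rewrite linearP !gP linearP.
by exists (mklin lg).
Qed.

Lemma factor_surj M X W (p : {linear M -> X}) (f : {linear M -> W}) :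
  surjective_map p -> (forall m, p m = 0 -> f m = 0) ->
  exists g : {linear X -> W}, forall m, g (p m) = f m.
Proof.
move=> /choice[s sP] h.
have e m m' : p m = p m' -> f m = f m'.
  move=> e; apply/subr0_eq; rewrite -linearB; apply: h.
  by rewrite linearB e subrr.
have lg : linear (fun x => f (s x)).
  by move=> a x y; rewrite -linearP; apply: e; rewrite linearP !sP.
by exists (mklin lg) => m; apply: e; rewrite sP.
Qed.

End Basics.

(** * Quotients and submodules as modules *)

Section Quotient.
Variables (A : pzRingType) (M : lmodType A) (U : M -> Prop).
Hypothesis sU : submod U.

Definition subpred : {pred M} := fun x => `[< U x >].

Fact subpred_closed : GRing.submod_closed subpred.
Proof.
split=> [|a x y]; rewrite !unfold_in; first by apply/asboolP; case: sU.
by move=> /asboolP ux /asboolP uy; apply/asboolP; apply: sU.2.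
Qed.
HB.instance Definition _ :=
  GRing.isSubmodClosed.Build A M subpred subpred_closed.

Let Q : zmodType := Quotient.quot subpred.


Local Open Scope quotient_scope.

Lemma pi_eq (x y : M) : (\pi_Q x = \pi_Q y) <-> U (x - y).
Proof.
have -> : (\pi_Q x = \pi_Q y) <-> (x == y %[mod Q]) by split=> /eqP.
by rewrite -Quotient.idealrBE; split=> /asboolP.
Qed.

(** Submodules are handled as predicates; this existential form and that of [sub_ex] hide how the
    modules are constructed. *)
Lemma quot_ex : exists (W : lmodType A) (p : {linear M -> W}),
  surjective_map p /\ forall x, p x = 0 <-> U x.
Proof.
pose sc (a : A) (x : Q) : Q := \pi_Q (a *: repr x).
have scE a x : sc a (\pi_Q x) = \pi_Q (a *: x).
  apply/pi_eq; rewrite -scalerBr; apply: submodZ => //; apply/pi_eq.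
  by rewrite reprK.
have D x y : \pi_Q (x + y) = \pi_Q x + \pi_Q y by rewrite raddfD.
have h1 a b v : sc a (sc b v) = sc (a * b) v.
  by rewrite [LHS]scE scalerA.
have h2 : left_id 1 sc by move=> v; rewrite /sc scale1r reprK.
have h3 : right_distributive sc +%R.
  by move=> a v w; rewrite -[in LHS](reprK v) -[in LHS](reprK w) -D scE scalerDr D.
have h4 v : {morph sc^~ v : a b / a + b}.
  by move=> a b; rewrite /sc scalerDl D.
pose W : lmodType A := HB.pack Q (GRing.Zmodule_isLmodule.Build A Q h1 h2 h3 h4).
have lp : linear (fun x => \pi_Q x : W).
  by move=> a x y; rewrite D; congr (_ + _); rewrite -scE.
have e0 : (0 : W) = \pi_Q 0 :> Q by rewrite raddf0.
exists W, (mklin lp); split=> [y|x]; first by exists (repr (y : Q));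
  rewrite /= reprK.
by rewrite e0 -[x in U x]subr0; apply: pi_eq.
Qed.
End Quotient.

Section Sub.
Variables (A : pzRingType).
Implicit Types M N K X Y Z W : lmodType A.

Lemma ker_inclP M N (f : {linear M -> N}) x :
  f x = 0 <-> exists z, @ker_incl A M N f z = x.
Proof.
split=> [fx|[z <-]]; last by apply/eqP; exact: (valP z).
have px : x \in kerp f by rewrite unfold_in fx.
by exists (Sub x px); rewrite /ker_incl SubK.
Qed.

Lemma ker_incl_inj M N (f : {linear M -> N}) : injective (@ker_incl A M N f).
Proof. exact: val_inj. Qed.

Lemma sub_ex M (U : M -> Prop) : submod U ->
  exists (K : lmodType A) (i : {linear K -> M}),
    injective i /\ forall x, U x <-> exists k, i k = x.
Proof.
move=> /quot_ex[W [p [_ pU]]]; exists (ker p), (@ker_incl A M W p).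
by split=> [|x]; [exact: ker_incl_inj | rewrite -pU ker_inclP].
Qed.
End Sub.

(** * Length *)

Section Length.
Variable A : pzRingType.
Implicit Types M N K S X Y Z W : lmodType A.

Definition simple_or_zero S : Prop :=
  forall x y : S, x <> 0 -> exists r, y = r *: x.

(* The maps f may vanish, so this is an upper bound on the length, which passes
   to submodules by restricting the f. *)
Fixpoint len_le (l : nat) M : Prop :=
  match l with
  | 0 => trivial_module M
  | k.+1 => exists (S : lmodType A) (f : {linear M -> S}),
      simple_or_zero S /\ len_le k (ker f)
  end.

Lemma len_leS l M : len_le l M -> len_le l.+1 M.
Proof.
elim: l M => [|l IH] M h; last first.
  by case: h => S [f [sS kf]]; exists S, f; split=> //; apply: IH.
exists M, (idfun : {linear M -> M}); split=> [x y|z]; first by rewrite (h x).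
by apply: ker_incl_inj; rewrite (h (ker_incl z)) linear0.
Qed.

Lemma len_le_inj l N M (i : {linear N -> M}) :
  injective i -> len_le l M -> len_le l N.
Proof.
elim: l N M i => [|l IH] N M i ii h.
  by move=> x; apply: ii; rewrite linear0 (h (i x)).
case: h => S [f [sS kf]]; exists S, (f \o i : {linear N -> S}); split=> //.
have [w|g gP] := @factor_inj _ _ _ _ (@ker_incl _ _ _ f)
  (i \o @ker_incl _ _ _ (f \o i : {linear N -> S})) (@ker_incl_inj _ _ _ f).
  by apply/ker_inclP; apply/(@ker_inclP _ _ _ (f \o i : {linear N -> S})); exists w.
apply: (IH _ _ g) kf => x y /(congr1 (@ker_incl _ _ _ f)).
by rewrite !gP => /ii /ker_incl_inj.
Qed.

Lemma len_le_into_ker l N M S (i : {linear N -> M}) (f : {linear M -> S}) :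
  injective i -> (forall x, f (i x) = 0) -> len_le l (ker f) -> len_le l N.
Proof.
move=> ii fi0; have [w|g gP] :=
  @factor_inj _ _ _ _ (@ker_incl _ _ _ f) i (@ker_incl_inj _ _ _ f).
  exact/ker_inclP.
apply: (len_le_inj (i := g)) => x y /(congr1 (@ker_incl _ _ _ f)).
by rewrite !gP => /ii.
Qed.

(** Let f : M -> S be the top map. If f vanishes on N, then N embeds in [ker f]. Otherwise f maps N
    onto S, so N cannot contain [ker f] without being M; its intersection with [ker f] is proper
    there, and the induction applies. *)
Lemma len_le_proper l N M (i : {linear N -> M}) :
  injective i -> ~ surjective_map i -> len_le l.+1 M -> len_le l N.
Proof.
move=> ii si h; have : exists (S : lmodType A) (f :
  {linear M -> S}), simple_or_zero S /\ len_le l (ker f) := h.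
move: {h} ii si => + + [S [f [sS kf]]].
elim: l N M i S f sS kf => [|l IH] N M i S f sS kf ii si;
  pose fi : {linear N -> S} := f \o i;
  (have [[n fn]|fi0] := pselect (exists n, fi n <> 0); last
    by (apply: (len_le_into_ker ii _ kf) => x; apply: contrapT => h;
      apply: fi0; exists x));
  (have nsurj : ~ (forall x, f x = 0 -> exists z, fi z = 0 /\ i z = x);
    [ move=> h; apply: si => m; have [r e] := sS _ (f m) fn;
      have [|z [_ iz]] := h (m - i (r *: n));
      [ by rewrite linearB e /fi /= linearZ linearZ subrr
      | by exists (z + r *: n); rewrite linearD iz subrK ]
    | ]).
  case: nsurj => x fx; exists 0; rewrite !linear0; split=> //.
  by have [z <-] := (ker_inclP f x).1 fx; rewrite (kf z) linear0.
have [w|g gP] := @factor_inj _ _ _ _ (@ker_incl _ _ _ f)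
  (i \o @ker_incl _ _ _ fi) (@ker_incl_inj _ _ _ f).
  by apply/ker_inclP; apply/(@ker_inclP _ _ _ fi); exists w.
exists S, fi; split=> //.
have [S' [f' [sS' kf']]] := kf; apply: (IH _ _ g _ _ sS' kf').
  by move=> x y /(congr1 (@ker_incl _ _ _ f)); rewrite !gP => /ii /ker_incl_inj.
move=> sg; apply: nsurj => x fx; have [z <-] := (ker_inclP f x).1 fx.
have [y <-] := sg z; exists (ker_incl y); rewrite gP; split=> //.
by apply/ker_inclP; exists y.
Qed.

Lemma len_le_ext a b M W (g : {linear M -> W}) :
  len_le a (ker g) -> len_le b W -> len_le (b + a)%N M.
Proof.
elim: b M W g => [|b IH] M W g ka.
  move=> tW; have [w|h hP] := @factor_inj _ _ _ _ (@ker_incl _ _ _ g)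
    (idfun : {linear M -> M}) (@ker_incl_inj _ _ _ g).
    by apply/ker_inclP; rewrite (tW (g _)).
  apply: (len_le_inj (i := h)) ka.
  by move=> x y /(congr1 (@ker_incl _ _ _ g)); rewrite !hP.
move=> [S [h [sS kh]]]; exists S, (h \o g : {linear M -> S}); split=> //.
pose hg : {linear M -> S} := h \o g.
have [w|k kP] := @factor_inj _ _ _ _ (@ker_incl _ _ _ h)
    (g \o @ker_incl _ _ _ hg) (@ker_incl_inj _ _ _ h).
  by apply/ker_inclP; apply/(@ker_inclP _ _ _ hg); exists w.
apply: (IH _ _ k) kh.
have [w|j jP] := @factor_inj _ _ _ _ (@ker_incl _ _ _ g)
    (@ker_incl _ _ _ hg \o @ker_incl _ _ _ k) (@ker_incl_inj _ _ _ g).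
  apply/ker_inclP; rewrite /= -[g _](kP (ker_incl w)).
  by rewrite (ker_inclP k _).2 ?linear0; last by exists w.
apply: (len_le_inj (i := j)) ka.
by move=> x y /(congr1 (@ker_incl _ _ _ g));
  rewrite !jP => /ker_incl_inj/ker_incl_inj.
Qed.

Lemma submod_range M N (f : {linear M -> N}) :
  submod (fun y => exists x, f x = y).
Proof.
split=> [|a _ _ [x <-] [y <-]]; first by exists 0; rewrite linear0.
by exists (a *: x + y); rewrite linearP.
Qed.

(** Dividing N by the image of [ker f] leaves a quotient of S, hence a simple or zero module; the
    kernel of that projection is an image of [ker f]. *)
Lemma len_le_surj l M N (p : {linear M -> N}) :
  surjective_map p -> len_le l M -> len_le l N.
Proof.
elim: l M N p => [|l IH] M N p sp.
  by move=> h y; have [x <-] := sp y; rewrite (h x) linear0.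
move=> [S [f [sS kf]]]; pose q : {linear _ -> N} := p \o @ker_incl _ _ _ f.
have [W [g [sg gP]]] := quot_ex (submod_range q).
exists W, g; split.
  move=> x y; have [x1 <-] := sg x; have [y1 <-] := sg y.
  have [m <-] := sp x1; have [m' <-] := sp y1 => gm.
  have fm : f m <> 0.
    by move=> /ker_inclP[z zm]; apply/gm/gP; exists z; rewrite /q /= zm.
  have [r e] := sS _ (f m') fm; exists r; apply/subr0_eq.
  rewrite -!linearZ -!linearB; apply/gP.
  have [|z zm] := (ker_inclP f (m' - r *: m)).1;
    first by rewrite linearB e linearZ subrr.
  by exists z; rewrite /q /= zm.
have [w|j jP] := @factor_inj _ _ _ _ (@ker_incl _ _ _ g) q (@ker_incl_inj _ _ _ g).
  by apply/ker_inclP/gP; exists w.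
apply: (IH _ _ j) kf => z;
  have /gP[x xz] : g (ker_incl z) = 0 by apply/ker_inclP; exists z.
by exists x; apply: ker_incl_inj; rewrite jP.
Qed.

Definition sub_len_le M (U : M -> Prop) (l : nat) : Prop :=
  exists (K : lmodType A) (i : {linear K -> M}),
    [/\ injective i, forall x, U x <-> exists k, i k = x & len_le l K].

Lemma sub_len_le_all l M (U : M -> Prop) :
  len_le l M -> submod U -> sub_len_le U l.
Proof.
move=> h /sub_ex[K [i [ii iU]]]; exists K, i; split=> //.
exact: len_le_inj ii h.
Qed.

Lemma sub_len_le_proper l M (U V : M -> Prop) : submod V ->
  (forall x, V x -> U x) -> sub_len_le U l.+1 -> ~ (forall x, U x -> V x) ->
  sub_len_le V l.
Proof.
move=> /sub_ex[N [j [ij jV]]] VU [K [i [ii iU h]]] UV.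
exists N, j; split=> //.
have [w|g gP] := @factor_inj _ _ _ _ i j ii.
  by apply/iU/VU/jV; exists w.
apply: (len_le_proper (i := g)) h.
  by move=> x y /(congr1 i); rewrite !gP => /ij.
move=> sg; apply: UV => x /iU[k <-]; have [n <-] := sg k.
by apply/jV; exists n; rewrite gP.
Qed.

Lemma sub_len_le0 M (U V : M -> Prop) : submod V ->
  sub_len_le U 0 -> forall x, U x -> V x.
Proof.
by move=> [V0 _] [K [i [ii iU h]]] x /iU[k <-]; rewrite (h k) linear0.
Qed.

(** A member with the least length bound is minimal, since a strictly smaller one would have a
    smaller bound. With [submod_max] this replaces the chain conditions. *)
Lemma submod_min l M (P : (M -> Prop) -> Prop) : len_le l M ->
  (forall U, P U -> submod U) -> (exists U, P U) ->
  exists U, P U /\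
    forall V, P V -> (forall x, V x -> U x) -> forall x, U x -> V x.
Proof.
move=> h sP [U0 PU0].
have ex : exists k, `[< exists U, P U /\ sub_len_le U k >].
  exists l; apply/asboolP; exists U0; split=> //.
  exact: sub_len_le_all (sP _ PU0).
have [/= k /asboolP[U [PU kU]] mk] := ex_minnP ex.
exists U; split=> // V PV VU; apply: contrapT => UV.
case: k kU mk => [|k] kU mk; first exact/UV/(sub_len_le0 (sP _ PV) kU).
have /mk : `[< exists U, P U /\ sub_len_le U k >].
  apply/asboolP; exists V; split=> //.
  exact: sub_len_le_proper (sP _ PV) VU kU UV.
by rewrite ltnn.
Qed.

(** If k + 1 is the least bound common to all members, some U violates the bound k; a member
    strictly above U would give U the bound k. *)
Lemma submod_max l M (P : (M -> Prop) -> Prop) : len_le l M ->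
  (forall U, P U -> submod U) -> (exists U, P U) ->
  exists U, P U /\
    forall V, P V -> (forall x, U x -> V x) -> forall x, V x -> U x.
Proof.
move=> h sP [U0 PU0].
have ex : exists k, `[< forall U, P U -> sub_len_le U k >].
  by exists l; apply/asboolP => U PU; apply: sub_len_le_all (sP _ PU).
have [/= [|k] /asboolP kU mk] := ex_minnP ex.
  exists U0; split=> // V PV _; exact: sub_len_le0 (sP _ PU0) (kU _ PV).
have [[U [PU nU]]|nex] := pselect (exists U, P U /\ ~ sub_len_le U k).
  exists U; split=> // V PV UV; apply: contrapT => VU; apply: nU.
  exact: sub_len_le_proper (sP _ PU) UV (kU _ PV) VU.
have /mk : `[< forall U, P U -> sub_len_le U k >].
  by apply/asboolP => U PU; apply: contrapT => nU; apply: nex; exists U.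
by rewrite ltnn.
Qed.

Lemma inj_endo_surj l M (f : {linear M -> M}) :
  len_le l M -> injective f -> surjective_map f.
Proof.
move=> h fi; have [|/= k /asboolP hk mk] := @ex_minnP (fun k => `[< len_le k M >]).
  by exists l; apply/asboolP.
apply: contrapT => nf; case: k hk mk => [|k] hk mk.
  by apply: nf => y; exists y; rewrite (hk y) linear0.
by have /asboolP/mk := len_le_proper fi nf hk; rewrite ltnn.
Qed.

(** The kernels of the iterates of f stabilise, say at k. An element of the kernel of f is the k-th
    iterate of some z, and z is killed by k + 1 iterations, hence by k. *)
Lemma surj_endo_inj l M (f : {linear M -> M}) :
  len_le l M -> surjective_map f -> injective f.
Proof.
move=> h sf.
pose P U := exists k, U = (fun x : M => iter k f x = 0).
have iterB k a x y : iter k f (a *: x + y) = a *: iter k f x + iter k f y.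
  by elim: k => //= k ->; rewrite linearP.
have iter_surj k y : exists x, iter k f x = y.
  elim: k y => [|k IH] y; first by exists y.
  by have [z <-] := sf y; have [x <-] := IH z; exists x.
have [||_ [[k ->] mk]] := @submod_max l M P h.
- move=> _ [k ->]; split=> [|a x y hx hy];
  last by rewrite iterB hx hy scaler0 addr0.
  by elim: k => //= k ->; rewrite linear0.
- by exists (fun x => iter 0 f x = 0), 0%N.
suff f0 x : f x = 0 -> x = 0.
  by move=> x y e; apply/subr0_eq/f0; rewrite linearB e subrr.
have [z <-] := iter_surj k x => fz.
apply: (mk (fun x => iter k.+1 f x = 0)) fz; first by exists k.+1.
by move=> y /= ->; rewrite linear0.
Qed.

Lemma fgmodP M : fgmod M <->
  exists m (p : {linear 'rV[A]_m -> M}), surjective_map p.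
Proof.
split=> [[m [g gP]]|[m [p sp]]].
  have lp : linear (fun v : 'rV[A]_m => \sum_i v 0 i *: g i).
    move=> a u v; rewrite scaler_sumr -big_split; apply: eq_bigr => i _.
    by rewrite !mxE scalerDl scalerA.
  exists m, (mklin lp) => x; have [c ->] := gP x.
  by exists (\row_i c i); apply: eq_bigr => i _; rewrite mxE.
exists m, (fun i => p (delta_mx 0 i)) => x; have [v <-] := sp x.
exists (v 0); rewrite {1}(row_sum_delta v) linear_sum.
by apply: eq_bigr => i _; rewrite linearZ.
Qed.

Lemma fgmod_rV m : fgmod 'rV[A]_m.
Proof. by apply/fgmodP; exists m, (idfun : {linear _ -> _}) => x; exists x. Qed.

Lemma fgmod_regular : fgmod (A^o : lmodType A).
Proof.
by exists 1%N, (fun=> 1) => x; exists (fun=> x); rewrite big_ord1 [_ *: _]mulr1.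
Qed.

Lemma fgmod_surj M N (p : {linear M -> N}) :
  surjective_map p -> fgmod M -> fgmod N.
Proof.
move=> sp /fgmodP[m [q sq]]; apply/fgmodP; exists m, (p \o q : {linear _ -> _}).
by move=> y; have [x <-] := sp y; have [z <-] := sq x; exists z.
Qed.

Lemma projective_rV m : projective 'rV[A]_m.
Proof.
move=> M N f g sf.
have /choice[s sP] (i : 'I_m) : exists y, f y = g (delta_mx 0 i) by apply: sf.
have lp : linear (fun v : 'rV[A]_m => \sum_i v 0 i *: s i).
  move=> a u v; rewrite scaler_sumr -big_split; apply: eq_bigr => i _.
  by rewrite !mxE scalerDl scalerA.
exists (mklin lp) => v; rewrite /= linear_sum {2}(row_sum_delta v) linear_sum.
by apply: eq_bigr => i _; rewrite !linearZ sP.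
Qed.

Lemma fgmod_ker M N (f : {linear M -> N}) (m0 : M) :
  (forall x, exists r, f (x - r *: m0) = 0) -> fgmod (ker f) -> fgmod M.
Proof.
move=> h [m [g gP]].
exists m.+1, (fun i => if unlift ord0 i is Some j then ker_incl (g j) else m0) => x.
have [r /ker_inclP[z zx]] := h x; have [c e] := gP z.
exists (fun i => if unlift ord0 i is Some j then c j else r).
rewrite big_ord_recl unlift_none -[LHS](subrK (r *: m0)) addrC; congr (_ + _).
rewrite -zx e linear_sum; apply: eq_bigr => i _.
by rewrite liftK linearZ.
Qed.

Lemma len_fgmod l M : len_le l M -> fgmod M.
Proof.
elim: l M => [|l IH] M.
  by move=> h; exists 0%N, (fun=> 0) => x; exists (fun=> 0); rewrite big_ord0 (h x).
move=> [S [f [sS /IH kf]]].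
have [[m0 fm0]|nf] := pselect (exists m0, f m0 <> 0).
  apply: (fgmod_ker (m0 := m0)) kf.
  by move=> x; have [r e] := sS _ (f x) fm0; exists r;
    rewrite linearB linearZ /= -e subrr.
apply: (fgmod_ker (m0 := 0)) kf.
move=> x; exists 0; rewrite scaler0 subr0.
by apply: contrapT => fx; apply: nf; exists x.
Qed.

Lemma len_rV l m : len_le l A^o -> exists l', len_le l' 'rV[A]_m.
Proof.
move=> h; elim: m => [|m [l' IH]].
  by exists 0%N => x; apply/rowP => -[].
pose f (v : 'rV[A]_m.+1) : A^o := v 0 0.
have lf : linear f by move=> a x y; rewrite /f !mxE.
pose g (v : 'rV[A]_m.+1) : 'rV[A]_m := \row_i v 0 (lift ord0 i).
have lg : linear g by move=> a x y; apply/rowP => i; rewrite !mxE.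
exists (l + l')%N; apply: (@len_le_ext _ _ _ _ (mklin lf)) h.
apply: (@len_le_inj _ _ _ (mklin lg \o @ker_incl _ _ _ (mklin lf))) IH => x y.
move=> /rowP /= e; apply: ker_incl_inj; apply/rowP => i.
have [j ->|->] := unliftP ord0 i; first by have := e j; rewrite !mxE.
have : mklin lf (ker_incl x) = 0 by apply/ker_inclP; exists x.
have : mklin lf (ker_incl y) = 0 by apply/ker_inclP; exists y.
by rewrite /= /f => -> ->.
Qed.

Lemma len_fg l M : len_le l A^o -> fgmod M -> exists l', len_le l' M.
Proof.
move=> h /fgmodP[m [p sp]]; have [l' h'] := len_rV m h.
by exists l'; apply: len_le_surj sp h'.
Qed.

End Length.

(** * Duals of modules over an algebra *)

(** Bundled so that L, its converse and R itself can be treated alike. *)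
Record algebra (R : comPzRingType) := Algebra {
  alg_ring :> pzRingType;
  alg_map : {rmorphism R -> alg_ring};
  alg_central : forall r x, alg_map r * x = x * alg_map r;
  alg_fg : exists m (g : 'I_m -> alg_ring), forall x, exists c : 'I_m -> R,
    x = \sum_(i < m) alg_map (c i) * g i
}.

Fact id_algebra_fg (R : comPzRingType) : exists m (g : 'I_m -> R),
  forall x, exists c : 'I_m -> R, x = \sum_(i < m) idfun (c i) * g i.
Proof.
by exists 1%N, (fun=> 1) => x; exists (fun=> x); rewrite big_ord1 mulr1.
Qed.

Definition id_algebra (R : comPzRingType) : algebra R :=
  @Algebra R R idfun (@mulrC R) (id_algebra_fg R).

(** Lets the dual of a left A-module be a left B-module, so that both sides are handled with left
    modules only. The identity of R is one, which makes Hom over R an instance of [dual]. *)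
Record antimorphism (R : comPzRingType) (A B : algebra R) := Antimorphism {
  am :> B -> A;
  amD : forall x y, am (x + y) = am x + am y;
  amM : forall x y, am (x * y) = am y * am x;
  am1 : am 1 = 1;
  amR : forall r, am (alg_map B r) = alg_map A r
}.

Definition id_antimorphism (R : comPzRingType) :
    antimorphism (id_algebra R) (id_algebra R) :=
  @Antimorphism R (id_algebra R) (id_algebra R) id (fun _ _ => erefl)
    (@mulrC R) erefl (fun _ => erefl).

Section Restriction.
Variables (R : comPzRingType) (A : algebra R).

Definition res (M : lmodType A) : Type := M.

Section Module.
Variable M : lmodType A.
HB.instance Definition _ := GRing.Zmodule.on (res M).

Definition res_scale (r : R) (x : res M) : res M := alg_map A r *: (x : M).

Fact res_scaleA a b v : res_scale a (res_scale b v) = res_scale (a * b) v.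
Proof. by rewrite /res_scale scalerA rmorphM. Qed.
Fact res_scale1 : left_id 1 res_scale.
Proof. by move=> v; rewrite /res_scale rmorph1 scale1r. Qed.
Fact res_scaleDr : right_distributive res_scale +%R.
Proof. by move=> a v w; rewrite /res_scale scalerDr. Qed.
Fact res_scaleDl v : {morph res_scale^~ v : a b / a + b}.
Proof. by move=> a b; rewrite /res_scale rmorphD scalerDl. Qed.

HB.instance Definition _ := GRing.Zmodule_isLmodule.Build R (res M)
  res_scaleA res_scale1 res_scaleDr res_scaleDl.

Lemma res_scaleE (r : R) (x : res M) : r *: x = alg_map A r *: (x : M).
Proof. by []. Qed.

End Module.

Fact res_map_linear (M N : lmodType A) (f : {linear M -> N}) :
  linear (f : res M -> res N).
Proof. by move=> r x y; rewrite !res_scaleE linearP. Qed.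

Definition res_map (M N : lmodType A) (f : {linear M -> N}) :
  {linear res M -> res N} := mklin (res_map_linear f).

End Restriction.

Section Dual.
Variables (R : comPzRingType) (A B : algebra R) (s : antimorphism A B).
Variable E : lmodType R.

Record dual (M : lmodType A) := Dual {
  dual_fun :> M -> E;
  dualP : forall r x y,
    dual_fun (alg_map A r *: x + y) = r *: dual_fun x + dual_fun y
}.

Section DualModule.
Variable M : lmodType A.

HB.instance Definition _ := gen_eqMixin (dual M).
HB.instance Definition _ := gen_choiceMixin (dual M).

Lemma dual_ext (f g : dual M) : (forall x, f x = g x) -> f = g.
Proof.
case: f g => [f Hf] [g Hg] /= /funext e.
by rewrite e in Hf *; rewrite (Prop_irrelevance Hf Hg).
Qed.

Lemma dualD (f : dual M) x y : f (x + y) = f x + f y.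
Proof. by rewrite -[x]scale1r -(rmorph1 (alg_map A)) dualP !(rmorph1, scale1r). Qed.

Lemma dual0 (f : dual M) : f 0 = 0.
Proof. by apply: (addrI (f 0)); rewrite -dualD !addr0. Qed.

Lemma dualZ (f : dual M) r x : f (alg_map A r *: x) = r *: f x.
Proof. by rewrite -[in LHS](addr0 (_ *: _)) dualP dual0 addr0. Qed.

Lemma dualB (f : dual M) x y : f (x - y) = f x - f y.
Proof. by apply/(addIr (f y)); rewrite -dualD !subrK. Qed.

Program Definition dual_zero : dual M := @Dual M (fun=> 0) _.
Next Obligation. by rewrite scaler0 addr0. Qed.

Program Definition dual_add (f g : dual M) : dual M :=
  @Dual M (fun x => f x + g x) _.
Next Obligation. by rewrite !dualP scalerDr addrACA. Qed.

Program Definition dual_opp (f : dual M) : dual M := @Dual M (fun x => - f x) _.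
Next Obligation. by rewrite !dualP scalerN opprD. Qed.

Program Definition dual_scale (b : B) (f : dual M) : dual M :=
  @Dual M (fun x => f (s b *: x)) _.
Next Obligation. by rewrite scalerDr scalerA -alg_central -scalerA dualP. Qed.

Fact dual_addA : associative dual_add.
Proof. by move=> f g h; apply: dual_ext => x /=; rewrite addrA. Qed.
Fact dual_addC : commutative dual_add.
Proof. by move=> f g; apply: dual_ext => x /=; rewrite addrC. Qed.
Fact dual_add0 : left_id dual_zero dual_add.
Proof. by move=> f; apply: dual_ext => x /=; rewrite add0r. Qed.
Fact dual_addN : left_inverse dual_zero dual_opp dual_add.
Proof. by move=> f; apply: dual_ext => x /=; rewrite addNr. Qed.

HB.instance Definition _ :=
  GRing.isZmodule.Build (dual M) dual_addA dual_addC dual_add0 dual_addN.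

Fact dual_scaleA a b f : dual_scale a (dual_scale b f) = dual_scale (a * b) f.
Proof. by apply: dual_ext => x /=; rewrite scalerA amM. Qed.
Fact dual_scale1 : left_id 1 dual_scale.
Proof. by move=> f; apply: dual_ext => x /=; rewrite am1 scale1r. Qed.
Fact dual_scaleDr : right_distributive dual_scale +%R.
Proof. by move=> a f g; apply: dual_ext. Qed.
Fact dual_scaleDl f : {morph dual_scale^~ f : a b / a + b}.
Proof. by move=> a b; apply: dual_ext => x /=; rewrite amD scalerDl dualD. Qed.

HB.instance Definition _ := GRing.Zmodule_isLmodule.Build B (dual M)
  dual_scaleA dual_scale1 dual_scaleDr dual_scaleDl.

Lemma dual_addE (f g : dual M) x : (f + g) x = f x + g x.
Proof. by []. Qed.
Lemma dual_zeroE x : (0 : dual M) x = 0.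
Proof. by []. Qed.
Lemma dual_oppE (f : dual M) x : (- f) x = - f x.
Proof. by []. Qed.
Lemma dual_scaleE b (f : dual M) x : (b *: f) x = f (s b *: x).
Proof. by []. Qed.
Definition dualE := (dual_addE, dual_zeroE, dual_oppE, dual_scaleE).

Definition dual_of_res (f : {linear res M -> E}) : dual M :=
  @Dual M f (fun r x y => linearP f r x y).

Fact dual_res_linear (f : dual M) : linear (f : res M -> E).
Proof. by move=> r x y; rewrite res_scaleE dualP. Qed.

Definition dual_to_res (f : dual M) : {linear res M -> E} :=
  mklin (dual_res_linear f).

End DualModule.

Definition Dmod (M : lmodType A) : lmodType B := dual M.

Section DualMap.
Variables (M N : lmodType A) (f : {linear M -> N}).

Program Definition dual_comp (g : dual N) : dual M := @Dual M (fun x => g (f x)) _.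
Next Obligation. by rewrite linearP dualP. Qed.

Fact dual_comp_linear : linear (dual_comp : Dmod N -> Dmod M).
Proof. by move=> b g h; apply: dual_ext => x /=; rewrite linearZ. Qed.

Definition Dmap : {linear Dmod N -> Dmod M} := mklin dual_comp_linear.

Lemma DmapE g x : Dmap g x = g (f x). Proof. by []. Qed.

End DualMap.

End Dual.

(** * Matlis duality over an artinian ring *)

Section ZornSub.
Variables (A : pzRingType) (M : lmodType A).

Lemma submod_zorn (U0 D : M -> Prop) : submod U0 -> (forall x, U0 x -> D x) ->
  exists W, [/\ submod W, forall x, U0 x -> W x, forall x, W x -> D x &
    forall V, submod V -> (forall x, W x -> V x) -> (forall x, V x -> D x) ->
      forall x, V x -> W x].
Proof.
move=> sU0 U0D.
(* The alternative [W = set0] is there for the empty chain, whose union is empty. *)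
pose P (W : set M) := [/\ forall a x y, W x -> W y -> W (a *: x + y),
  forall x, W x -> D x & W = set0 \/ forall x, U0 x -> W x].
have [F FP tot|W [[cW WD W0] mW]] := @Zorn_bigcup M P.
  split=> [a x y [V FV Vx] [V' FV' V'y]|x [V FV Vx]|].
  - have [/(_ _ Vx) V'x|/(_ _ V'y) Vy] := tot _ _ FV FV'.
      by exists V' => //; have [h _ _] := FP _ FV'; apply: h.
    by exists V => //; have [h _ _] := FP _ FV; apply: h.
  - by have [_ h _] := FP _ FV; apply: h.
  - have [[V [FV V0]]|h] := pselect (exists V, F V /\ V <> set0); [right|left].
      by move=> x U0x; exists V => //; have [_ _ [|]] := FP _ FV => //; apply.
    apply/seteqP; split=> // x [V FV Vx]; apply: h; exists V; split=> // V0.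
    by rewrite V0 in Vx.
have UW x : U0 x -> W x.
  case: W0 => [W0|]; last by apply.
  case: (mW U0); last by split=> //; [exact: sU0.2 | right].
  rewrite W0; split=> // h; exact: (h 0 sU0.1).
exists W; split=> //; first by split; [exact/UW/sU0.1 | exact: cW].
move=> V sV WV VD x Vx; apply: contrapT => nWx; case: (mW V).
  by split=> // h; apply/nWx/h.
by split=> //; [exact: sV.2 | right=> y /UW/WV].
Qed.

End ZornSub.

Section Artinian.
Variable R : comPzRingType.
Hypothesis artR : artinian R.
Implicit Types M N K : lmodType R.

Lemma len_le1 (A : pzRingType) (S : lmodType A) : simple_or_zero S -> len_le 1 S.
Proof.
move=> sS; exists S, (idfun : {linear S -> S}); split=> // z.
by apply: ker_incl_inj; rewrite linear0;
  apply: (ker_inclP (idfun : {linear S -> S}) _).2; exists z.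
Qed.

Lemma artinian_pow (r : R) : exists k s, r ^+ k = r ^+ k.+1 * s.
Proof.
have [|k x|m /(_ m.+1 (leqnSn m))] := artR (I :=
  fun k x => exists s, x = r ^+ k * s).
- move=> k; split=> [|x y [a ->] [b ->]|a x [b ->]]; first by exists 0;
  rewrite mulr0.
    by exists (a + b); rewrite mulrDr.
  by exists (a * b); rewrite mulrCA.
- by move=> [s ->]; exists (r * s); rewrite mulrA -exprSr.
- by move=> /(_ (r ^+ m))[|s e]; [exists 1; rewrite mulr1 | exists m, s].
Qed.

Fact scale_linear M (r : R) : linear (fun x : M => r *: x).
Proof. by move=> a x y; rewrite scalerDr !scalerA mulrC. Qed.

(* Each scalar kills M or is onto, so R / ann M is a field by the descending
   chain condition; a maximal submodule avoiding a given vector then has a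
   simple quotient. *)
Lemma len_of_proper M :
  (forall N (j : {linear N -> M}), injective j -> ~ surjective_map j ->
    exists l, len_le l N) ->
  exists l, len_le l M.
Proof.
move=> h; apply: contrapT => nl.
(* Otherwise the kernel and the image of scaling by r are both proper, hence of finite length, and M
   is an extension of one by the other. *)
have h1 r : (forall x : M, r *: x = 0) \/ (forall y : M, exists x, y = r *: x).
  apply: contrapT => /not_orP[n0 ns]; apply: nl.
  pose f : {linear M -> M} := mklin (scale_linear (M := M) r).
  have [|l1 k1] := h _ (@ker_incl _ _ _ f) (@ker_incl_inj _ _ _ f).
    by move=> sj; apply: n0 => x; have [z <-] := sj x;
      apply: (ker_inclP f _).2; exists z.
  have [N [j [ij jU]]] := sub_ex (submod_range f).
  have [|l2 k2] := h _ j ij.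
    move=> sj; apply: ns => y; have [z zy] := sj y.
    by have [x <-] := (jU y).2 (ex_intro _ z zy); exists x.
  have [w|g gP] := @factor_inj _ _ _ _ j f ij; first by apply/jU; exists w.
  exists (l2 + l1)%N; apply: (len_le_ext (g := g)) k2.
  apply: (len_le_into_ker (i := @ker_incl _ _ _ g) (f := f)) k1 => [|x].
    exact: ker_incl_inj.
  by rewrite -gP (ker_inclP g _).2 ?linear0 //; exists x.
(* When r acts onto M, every x is a multiple of the power r^k, and r^k = r^(k+1) s makes s the
   inverse of r on such x. *)
have h2 r : (forall x : M, r *: x = 0) \/ exists s, forall x : M, s *: (r *: x) = x.
  have [|sr] := h1 r; [by left | right].
  have [k [s e]] := artinian_pow r; exists s => x.
  have [y ->] : exists y, x = r ^+ k *: y.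
    elim: k x {e} => [|k IH] x; first by exists x; rewrite expr0 scale1r.
    by have [z ->] := sr x; have [y ->] := IH z; exists y; rewrite scalerA exprS.
  by rewrite !scalerA -mulrA -exprS mulrC -e.
have [[v v0]|tM] := pselect (exists v : M, v <> 0); last first.
  by apply: nl; exists 0%N => x; apply: contrapT => x0; apply: tM; exists x.
have [||W [sW _ Wv mW]] := @submod_zorn _ M (fun x => x = 0) (fun x => x <> v).
- exact: submod0.
- by move=> _ -> /esym.
have gen u : ~ W u -> exists w a, W w /\ v = w + a *: u.
  move=> nWu; apply: contrapT => nex; apply: nWu.
  apply: (mW (fun x => exists w a, W w /\ x = w + a *: u)).
  - exact: submod_adjoin.
  - by move=> x Wx; exists x, 0; rewrite scale0r addr0.
  - by move=> x [w [a [Ww ->]]] e; apply: nex; exists w, a.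
  - by exists 0, 1; rewrite scale1r add0r; split=> //; apply: sW.1.
have [N [j [ij jW]]] := sub_ex sW; have [|l kl] := h _ j ij.
  by move=> sj; case: (Wv v) => //; apply/jW/sj.
have [Q [q [sq qW]]] := quot_ex sW; apply: nl; exists (1 + l)%N.
apply: (len_le_ext (g := q)).
  have [w|g gP] := @factor_inj _ _ _ _ j (@ker_incl _ _ _ q) ij.
    by apply/jW/qW/ker_inclP; exists w.
  apply: (len_le_inj (i := g)) kl => x y /(congr1 j).
  by rewrite !gP => /ker_incl_inj.
apply: len_le1 => x y; have [u <-] := sq x; have [u' <-] := sq y => qu.
have nWu : ~ W u by move=> /qW.
have [Wu'|nWu'] := pselect (W u').
  by exists 0; rewrite scale0r; apply/qW.
have [w [a [Ww e]]] := gen _ nWu; have [w' [a' [Ww' e']]] := gen _ nWu'.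
have [a'0|[b bP]] := h2 a'.
  by case: (Wv v) => //; rewrite e' a'0 addr0.
exists (b * a); apply/subr0_eq; rewrite -linearZ -linearB; apply/qW.
have -> : u' - (b * a) *: u = b *: (w - w').
  rewrite -[in LHS](bP u') -scalerA -scalerBr; congr (_ *: _).
  have -> : a' *: u' = v - w' by rewrite e' addrC addKr.
  have -> : a *: u = v - w by rewrite e addrC addKr.
  by rewrite opprB addrC addrA subrK.
by apply: submodZ => //; apply: submodB.
Qed.

(** By [len_of_proper], an ideal of infinite length strictly contains another one; if R had infinite
    length, choice would give a strictly descending sequence of ideals. *)
Lemma artinian_len : exists l, len_le l (R^o : lmodType R).
Proof.
apply: contrapT => nl.
pose P (U : R^o -> Prop) := submod U /\ ~ exists l, sub_len_le U l.
have next (U : {U | P U}) : exists V : {U | P U},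
    (forall x, sval V x -> sval U x) /\ ~ (forall x, sval U x -> sval V x).
  case: U => U [sU nU] /=; have [K [i [ii iU]]] := sub_ex sU.
  have [N [j [ij sj nN]]] : exists N (j : {linear N -> K}),
      [/\ injective j, ~ surjective_map j & ~ exists l, len_le l N].
    apply: contrapT => h; apply: nU.
    have [N j ij sj|l kl] := @len_of_proper K; last by exists l, K, i.
    by apply: contrapT => nN; apply: h; exists N, j.
  have PV : P (fun y => exists x, i (j x) = y).
    split; first exact: (submod_range (i \o j : {linear N -> R^o})).
    move=> [l [N' [i' [ii' iV kl]]]]; apply: nN; exists l.
    have [w|g gP] := @factor_inj _ _ _ _ i' (i \o j : {linear N -> R^o}) ii';
      first by apply/iV; exists w.
    by apply: (len_le_inj (i := g)) kl => x y /(congr1 i'); rewrite !gP => /ii/ij.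
  exists (exist _ _ PV); split=> /= [_ [x <-]|h]; first by apply/iU; exists (j x).
  apply: sj => y; have [|x e] := h (i y); first by apply/iU; exists y.
  by exists x; apply: ii.
have PT : P (fun=> True).
  split=> // -[l [K [i [ii iT kl]]]]; apply: nl; exists l.
  have [w|g gP] := @factor_inj _ _ _ _ i (idfun : {linear R^o -> R^o}) ii.
    exact/iT.
  by apply: (len_le_inj (i := g)) kl => x y /(congr1 i); rewrite !gP.
have [f fP] := choice next.
pose I k := sval (iter k f (exist _ _ PT)).
have [k|k x|m /(_ m.+1 (leqnSn m))] := artR (I := I).
- have [sI _] := svalP (iter k f (exist _ _ PT)).
  split=> [|x y|a x]; [exact: sI.1 | exact: (submodD sI) | exact: (submodZ a sI)].
- exact: (fP _).1.
- exact: (fP _).2.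
Qed.

End Artinian.

Section Thin.
Variable R : comPzRingType.
Implicit Types M N K E : lmodType R.

Definition simple_gen M (x : M) : Prop :=
  x <> 0 /\ forall r, r *: x <> 0 -> exists s, s *: (r *: x) = x.

(* The thin modules are those in which every simple module embeds in at most
   one way up to automorphism, i.e., the submodules of the minimal injective
   cogenerator. *)
Definition thin E : Prop := forall x y : E, simple_gen x ->
  (forall r, r *: x = 0 -> r *: y = 0) -> exists r, y = r *: x.

Let Hom N E : lmodType R := Dmod (id_antimorphism R) E N.

Lemma HomZ N E (f : Hom N E) (r : R) x : f (r *: x) = r *: f x.
Proof. exact: (dualZ f). Qed.

(** Restriction to [ker f] has as kernel the maps that vanish on [ker f]. A nonzero such map a sends
    some u to a simple generator, and thinness makes b u a multiple of a u for any other such b; u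
    generates N modulo [ker f], so b is a multiple of a. *)
Lemma len_Hom E l N : thin E -> len_le l N -> len_le l (Hom N E).
Proof.
move=> tE; elim: l N => [|l IH] N.
  by move=> tN f; apply: dual_ext => x; rewrite (tN x) dual0.
move=> [S [f [sS kf]]].
pose g : {linear Hom N E -> Hom (ker f) E} :=
  Dmap (id_antimorphism R) E (@ker_incl _ _ _ f : {linear (ker f :
    lmodType (id_algebra R)) -> (N : lmodType (id_algebra R))}).
have kg (h : ker g) x : f x = 0 -> (ker_incl h : Hom N E) x = 0.
  move=> /ker_inclP[z <-]; have : g (ker_incl h) = 0 by apply/ker_inclP; exists h.
  by move=> /(congr1 (fun k : Hom (ker f) E => k z)).
rewrite -add1n addnC; apply: (len_le_ext (g := g)) (IH _ kf).
apply: len_le1 => a b a0.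
have [u au] : exists u, (ker_incl a : Hom N E) u <> 0.
  apply: contrapT => h; apply: a0; apply: ker_incl_inj; apply: dual_ext => u.
  by rewrite linear0; apply: contrapT => au; apply: h; exists u.
have fu : f u <> 0 by move=> /kg.
have red (h : ker g) x r : f x = r *: f u ->
    (ker_incl h : Hom N E) x = r *: (ker_incl h : Hom N E) u.
  move=> e; apply/subr0_eq; rewrite -HomZ -dualB; apply: kg.
  by rewrite linearB linearZ /= e subrr.
have inv r : r *: f u <> 0 -> exists s, f u = s *: (r *: f u).
  exact: sS.
have [|r0 r0u|r bE] := tE ((ker_incl a : Hom N E) u) ((ker_incl b : Hom N E) u).
- split=> // r rau; have [|s e] := inv r.
    by move=> e; apply: rau; rewrite -HomZ; apply: kg; rewrite linearZ.
  by exists s; rewrite scalerA; apply: esym; apply: red; rewrite -scalerA.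
- have [e|/inv[s e]] := pselect (r0 *: f u = 0).
    by rewrite -HomZ; apply: kg; rewrite linearZ.
  case: au; have -> : (ker_incl a : Hom N E) u = (s * r0) *: (ker_incl a :
    Hom N E) u.
    by apply: red; rewrite -scalerA.
  by rewrite -scalerA r0u scaler0.
exists r; apply: ker_incl_inj; apply: dual_ext => x.
have [s e] := sS _ (f x) fu.
rewrite linearZ; apply: etrans (red b x s e) _; rewrite bE.
apply: etrans (esym (HomZ (ker_incl a) r x)); rewrite (red a x s e).
by rewrite !scalerA mulrC.
Qed.

Lemma len_thin l E : len_le l (R^o : lmodType R) -> thin E -> len_le l E.
Proof.
move=> lR tE; have lH := len_Hom tE lR.
have fP (e : E) (r x y : R) : (r * x + y) *: e = r *: (x *: e) + y *: e.
  by rewrite scalerDl scalerA.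
pose f (e : E) : Hom R^o E :=
  @Dual R (id_algebra R) E (R^o : lmodType R) (fun r : R => r *: e) (fP e).
have lf : linear f.
  move=> a x y; apply: dual_ext => r; apply: etrans (scalerDr r (a *: x) y) _.
  by rewrite scalerA mulrC.
apply: (len_le_inj (i := mklin lf)) lH => x y /(congr1 (fun k : Hom R^o E => k 1)).
by rewrite /= !scale1r.
Qed.

End Thin.

Section Cogenerator.
Variable R : comPzRingType.
Implicit Types M N S E Y : lmodType R.

Definition maximal_thin E : Prop := thin E /\
  forall Y (i : {linear E -> Y}), thin Y -> injective i -> surjective_map i.

Lemma maximal_thin_ex : artinian R -> exists E, maximal_thin E.
Proof.
move=> /artinian_len[l lR].
have ex : exists k, `[< forall E, thin E -> len_le k E >].
  by exists l; apply/asboolP => E; apply: len_thin.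
have [/= [|k] /asboolP hk mk] := ex_minnP ex.
  exists 'rV[R]_0; split=> [x y _ _|Y i /hk tY _ y].
    by exists 0; apply/rowP => -[].
  by exists 0; rewrite (tY y) linear0.
have [E [tE nE]] : exists E, thin E /\ ~ len_le k E.
  apply: contrapT => h.
  have /mk : `[< forall E, thin E -> len_le k E >].
    by apply/asboolP => E tE; apply: contrapT => nE; apply: h; exists E.
  by rewrite ltnn.
exists E; split=> // Y i /hk kY ii; apply: contrapT => si.
by apply: nE; apply: len_le_proper kY; [exact: ii | exact: si].
Qed.

(** Essential extensions add no simple submodules. If y generates a simple module and the
    annihilator of y kills u, an s with s r y = y also satisfies s r u = u; so u lies in E as soon
    as its multiple r u does. *)
Lemma thin_essential E Y (i : {linear E -> Y}) :
  (forall y, y <> 0 -> exists r e, r *: y = i e /\ e <> 0) -> injective i ->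
  thin E -> thin Y.
Proof.
move=> ess ii tE y z [y0 sy] yz.
have i0 e : e <> 0 -> i e <> 0 by move=> e0 ie; apply: e0; apply: ii;
  rewrite linear0.
have in_E u : u <> 0 -> (forall r, r *: y = 0 -> r *: u = 0) -> exists e, u = i e.
  move=> u0 yu; have [r [e [ru e0]]] := ess u u0.
  have [|s sry] := sy r; first by move=> /yu; rewrite ru; apply: i0.
  exists (s *: e); rewrite linearZ /= -ru; apply/eqP; rewrite eq_sym -subr_eq0.
  apply/eqP; have := yu (s * r - 1); rewrite !scalerBl !scale1r -!scalerA; apply.
  by rewrite sry subrr.
have [z0|z0] := pselect (z = 0); first by exists 0; rewrite scale0r.
have [a ya] : exists a, y = i a by apply: in_E.
have [b zb] := in_E z z0 yz.
have iz r e : r *: i e = 0 <-> r *: e = 0.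
  by rewrite -linearZ; split=> [h|->]; [apply: ii;
    rewrite linear0 | rewrite linear0].
have [||r bE] := tE a b; last 1 first.
- by exists r; rewrite zb ya bE linearZ.
- split=> [a0|r ra]; first by apply: y0; rewrite ya a0 linear0.
  have [|s e] := sy r; first by rewrite ya => /iz.
  by exists s; apply: ii; rewrite !linearZ /= -ya.
- by move=> r /iz; rewrite -ya => /yz; rewrite zb => /iz.
Qed.

(* Given f : M -> N injective and g : M -> E, divide E x N by a maximal submodule
   containing the graph of (g, - f) and meeting E trivially: the quotient is an
   essential extension of E, hence E itself. *)
Lemma maximal_thin_injective E : maximal_thin E -> injective_module E.
Proof.
move=> [tE mE] M N f g fi.
(* A submodule contained in [D] meets E x 0 only in 0. *)
pose D (z : E * N) := z.2 = 0 -> z.1 = 0.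
have lG : linear (fun m => (g m, - f m) : E * N).
  by move=> a x y; congr (_, _); rewrite linearP //= opprD scalerN.
have [_ [m <-] /= /eqP|W [sW GW WD mW]] :=
  @submod_zorn _ _ _ D (submod_range (mklin lG)).
  rewrite oppr_eq0 => /eqP fm; have -> : m = 0 by apply: fi; rewrite linear0.
  by rewrite linear0.
have [Y [q [sq qW]]] := quot_ex sW.
have li : linear (fun e => (e, 0) : E * N).
  by move=> a x y; congr (_, _); rewrite /= scaler0 addr0.
pose i : {linear E -> Y} := q \o mklin li.
have ii : injective i.
  move=> x y /eqP; rewrite -subr_eq0 -linearB => /eqP/qW/WD e.
  by apply/subr0_eq/e.
have tY : thin Y.
  apply: (thin_essential (i := i)) tE => // y y0; have [z zy] := sq y.
  have nWz : ~ W z by move=> /qW; rewrite zy.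
  pose V u := exists w a, W w /\ u = w + a *: z.
  have [u [[w [r [Ww uE]]] [u2 u1]]] : exists u, V u /\ u.2 = 0 /\ u.1 <> 0.
    apply: contrapT => h; apply: nWz; apply: (mW V).
    - exact: submod_adjoin.
    - by move=> x Wx; exists x, 0; rewrite scale0r addr0.
    - by move=> u Vu u2; apply: contrapT => u1; apply: h; exists u.
    - by exists 0, 1; rewrite scale1r add0r; split=> //; apply: sW.1.
  exists r, u.1; split=> //; rewrite -zy -linearZ; apply/subr0_eq.
  rewrite -linearB; apply/qW.
  have -> : r *: z - mklin li u.1 = - w.
    have -> : mklin li u.1 = u by rewrite [u]surjective_pairing /= u2.
    by rewrite uE opprD addrCA subrr addr0.
  by rewrite -sub0r; apply: submodB => //; apply: sW.1.
have lj : linear (fun n => (0, n) : E * N).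
  by move=> a x y; congr (_, _); rewrite /= scaler0 addr0.
have [n|h hP] := @factor_inj _ _ _ _ i (q \o mklin lj) ii; first exact: mE tY ii _.
exists h => m; apply: ii; rewrite hP /i /=; apply/esym/subr0_eq; rewrite -linearB.
apply/qW/GW; exists m => /=; congr (_, _); first by rewrite subr0.
by rewrite sub0r.
Qed.

(* Otherwise E x S would still be thin. *)
Lemma maximal_thin_hom E S (x : S) : maximal_thin E -> x <> 0 ->
  (forall y : S, y <> 0 -> exists r, x = r *: y) -> (forall y :
    S, exists r, y = r *: x) ->
  exists e : E, e <> 0 /\ forall r, r *: x = 0 -> r *: e = 0.
Proof.
move=> [tE mE] x0 sx gx; apply: contrapT => nE.
have {}nE (s : S) (e : E) : s <> 0 -> (forall r, r *: s = 0 -> r *: e = 0) -> e = 0.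
  move=> s0 se; apply: contrapT => e0; apply: nE; exists e; split=> // r rx.
  by apply: se; have [u ->] := gx s; rewrite scalerA mulrC -scalerA rx scaler0.
have li : linear (fun e => (e, 0) : E * S).
  by move=> a u v; congr (_, _); rewrite /= scaler0 addr0.
have ii : injective (mklin li) by move=> u v /= [].
have tY : thin (E * S)%type.
  move=> [e s] [e' s'] [es0 ges] ann.
  have ge r : r *: (e, s) <> 0 -> exists t, t *: (r *: e) = e /\ t *: (r *: s) = s.
    by move=> /ges[t [te ts]]; exists t.
  (* A simple generator with both components nonzero would map S nontrivially to E, so one component
     is 0 and thinness is checked inside a single factor. *)
  have [s0|s0] := pselect (s = 0); last first.
    have e0 : e = 0.
      apply: (nE s) => // r rs; apply: contrapT => re.
      have [|t [_ ts]] := ge r; first by move=> /(congr1 fst)/re.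
      by apply: s0; rewrite -ts rs scaler0.
    have e'0 : e' = 0.
      apply: (nE s) => // r rs; apply: (congr1 fst (ann r _)).
      by congr (_, _); rewrite ?e0 ?scaler0.
    have [u ->] := gx s'; have [t ->] := sx s s0; exists (u * t).
    by congr (_, _); rewrite ?e0 ?e'0 ?scaler0 ?scalerA.
  have e0 : e <> 0 by move=> e0; apply: es0; rewrite e0 s0.
  have anne r : r *: e = 0 -> r *: e' = 0 /\ r *: s' = 0.
    move=> re; have /ann h : r *: (e, s) = 0 by rewrite s0; congr (_, _);
      rewrite ?scaler0.
    by split; [exact: (congr1 fst h) | exact: (congr1 snd h)].
  have s'0 : s' = 0.
    apply: contrapT => s'0; apply: e0; apply: (nE s') => // r rs'.
    apply: contrapT => re; have [|t [te _]] := ge r;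
      first by move=> /(congr1 fst)/re.
    apply: s'0; have [|_] := anne (t * r - 1).
      by rewrite scalerBl scale1r -scalerA te subrr.
    by rewrite scalerBl scale1r -scalerA rs' scaler0 sub0r => /eqP;
      rewrite oppr_eq0 => /eqP.
  have [||r ->] := tE e e'; last 1 first.
  - by exists r; congr (_, _); rewrite /= ?s0 ?s'0 ?scaler0.
  - split=> // r re; have [|t [te _]] := ge r; first by move=> /(congr1 fst)/re.
    by exists t.
  - by move=> r /anne[].
have [e /= [_ e0]] := mE _ _ tY ii (0, x).
by apply: x0.
Qed.

(** Divide M by a submodule maximal among those that avoid x: the image of x then generates a simple
    module S, which maps nontrivially to E, and injectivity of E extends this map to the
    quotient. *)
Lemma maximal_thin_cogenerator E M (x : M) : maximal_thin E -> x <> 0 ->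
  exists f : {linear M -> E}, f x <> 0.
Proof.
move=> mE x0; have iE := maximal_thin_injective mE.
have [||U [sU _ Ux mU]] := @submod_zorn _ M (fun y => y = 0) (fun y => y <> x).
- exact: submod0.
- by move=> _ -> /esym.
have [Q [q [sq qU]]] := quot_ex sU.
have qx : q x <> 0 by move=> /qU/Ux.
have gen y : q y <> 0 -> exists r, q x = r *: q y.
  move=> qy; apply: contrapT => nr; apply: qy; apply/qU.
  apply: (mU (fun z => exists w a, U w /\ z = w + a *: y)).
  - exact: submod_adjoin.
  - by move=> z Uz; exists z, 0; rewrite scale0r addr0.
  - move=> z [w [a [Uw ->]]] e; apply: nr; exists a.
    by rewrite -e linearD linearZ (qU w).2 // add0r.
  - by exists 0, 1; rewrite scale1r add0r; split=> //; apply: sU.1.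
have [S [j [ij jU]]] := sub_ex (submod_range (scaler_map (q x))).
have [sx jx] : exists s, j s = q x by apply/jU; exists 1; rewrite /= scale1r.
have gS y : exists r, y = r *: sx.
  have [r /= e] := (jU (j y)).2 (ex_intro _ y erefl).
  by exists r; apply: ij; rewrite linearZ /= jx.
have [| y y0 |//|e [e0 ann]] := @maximal_thin_hom E S sx mE.
- by move=> s0; apply: qx; rewrite -jx s0 linear0.
- have [z zy] := sq (j y); have [|r e] := gen z.
    by rewrite zy => e; apply: y0; apply: ij; rewrite linear0.
  by exists r; apply: ij; rewrite linearZ /= jx e zy.
have [y|//|g gP] := @factor_surj _ _ _ _ (scaler_map sx) (scaler_map e).
  by have [r ->] := gS y; exists r.
have [h hP] := iE _ _ j g ij.
exists (h \o q) => /=; rewrite -jx hP -[sx]scale1r => h0.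
by apply: e0; rewrite -h0 -[RHS]/(g (scaler_map sx 1)) gP /= scale1r.
Qed.
End Cogenerator.

(** * Finite length of finitely generated modules over an artin algebra *)

Section FiniteLength.
Variables (R : comPzRingType) (A : algebra R).
Implicit Types M N K : lmodType A.

Lemma fgmod_of_res M : fgmod (res M) -> fgmod M.
Proof.
move=> [m [g gP]]; exists m, g => x; have [c ->] := gP x.
by exists (fun i => alg_map A (c i)).
Qed.

Lemma res_fgmod M : fgmod M -> fgmod (res M).
Proof.
move=> [m [g gP]]; have [k [e eP]] := alg_fg A.
have h (x : res M) : exists c :
  'I_m * 'I_k -> R, x = \sum_i c i *: (e i.2 *: g i.1 : res M).
  have [c ->] := gP x; have /choice[d dP] i := eP (c i).
  exists (fun i => d i.1 i.2).
  rewrite -(pair_bigA _ (fun i j => d i j *: (e j *: g i : res M))) /=.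
  apply: eq_bigr => i _; rewrite {1}(dP i) scaler_suml; apply: eq_bigr => j _.
  by rewrite res_scaleE scalerA.
exists #|{: 'I_m * 'I_k}|, (fun i => e (enum_val i).2 *: g (enum_val i).1) => x.
have [c ->] := h x; exists (c \o enum_val).
by rewrite (reindex _ (onW_bij _ (@enum_val_bij _))).
Qed.

Hypothesis artR : artinian R.

Lemma res_len M : fgmod M -> exists l, len_le l (res M).
Proof. by have [l lR] := artinian_len artR => /res_fgmod/(len_fg lR). Qed.

Lemma submod_res M (U : M -> Prop) : submod U -> submod (U : res M -> Prop).
Proof. by move=> [U0 UP]; split=> // r x y; rewrite res_scaleE; apply: UP. Qed.

(** Length over R supplies maximal and minimal submodules over A. Take U maximal of finite length
    over A; if it is not M, a V minimal strictly above U has a simple quotient V/U, hence finite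
    length, against maximality. *)
Lemma len_of_res l M : len_le l (res M) -> exists l', len_le l' M.
Proof.
move=> h.
have [||U [[sU [l1 [K1 [i1 [ii1 iU1 k1]]]]] mU]] := submod_max
  (P := fun U : res M -> Prop => submod (U :
    M -> Prop) /\ exists l', sub_len_le (U : M -> Prop) l') h.
- by move=> U [/submod_res].
- exists (fun x => x = 0).
  split; first exact: submod0.
  exists 0%N; have [K [i [ii iU]]] := sub_ex (submod0 M); exists K, i; split=> // k.
  by apply: ii; rewrite linear0; apply/iU; exists k.
have [UT|nUT] := pselect (forall x, U x).
  exists l1; have [w|g gP] := @factor_inj _ _ _ _ i1 (idfun : {linear M -> M}) ii1.
    exact/iU1.
  by apply: (len_le_inj (i := g)) k1 => x y /(congr1 i1); rewrite !gP.
have [||V [[sV UV VU] mV]] := submod_min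
  (P := fun V : res M -> Prop => [/\ submod (V :
    M -> Prop), forall x, U x -> V x & ~ forall x, V x -> U x]) h.
- by move=> V [/submod_res].
- by exists (fun=> True); split=> // h'; apply: nUT => x; apply: h'.
case: VU; apply: (mU V) => //; split=> //.
have [K [i [ii iV]]] := sub_ex sV.
have sU' : submod (fun k => U (i k)).
  by split=> [|a x y]; rewrite ?linear0 ?linearP; [exact: sU.1 | exact: sU.2].
have [W [q [sq qU]]] := quot_ex sU'.
exists (1 + l1)%N, K, i; split=> //; apply: (len_le_ext (g := q)).
  have [w|g gP] := @factor_inj _ _ _ _ i1 (i \o @ker_incl _ _ _ q) ii1.
    by apply/iU1/qU/ker_inclP; exists w.
  apply: (len_le_inj (i := g)) k1 => x y /(congr1 i1).
  by rewrite !gP => /ii/ker_incl_inj.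
apply: len_le1 => x y; have [k <-] := sq x; have [k' <-] := sq y => qk.
have nUk : ~ U (i k) by move=> /qU.
have Vi z : V (i z) by apply/iV; exists z.
have [||u [a [Uu e]]] :=
  mV (fun z => exists u a, U u /\ z = u + a *: i k) _ _ (i k') (Vi k').
- split=> [|z Uz|h'].
  + exact: submod_adjoin.
  + by exists z, 0; rewrite scale0r addr0.
  + apply/nUk/h'; exists 0, 1; rewrite scale1r add0r; split=> //; exact: sU.1.
- move=> z [u [a [Uu ->]]]; apply: (submodD sV); first exact: UV.
  exact: (submodZ _ sV).
exists a; apply/subr0_eq; rewrite -linearZ -linearB; apply/qU.
by rewrite linearB linearZ /= e addrK.
Qed.

Lemma fgmod_len M : fgmod M -> exists l, len_le l M.
Proof. by move=> /res_len[l /len_of_res]. Qed.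

Lemma fgmod_inj N M (i : {linear N -> M}) : injective i -> fgmod M -> fgmod N.
Proof. by move=> ii /fgmod_len[l /(len_le_inj ii)/len_fgmod]. Qed.

End FiniteLength.

(** * Duality between modules over opposite algebras *)

Record opposite (R : comPzRingType) (A B : algebra R) := Opposite {
  opp_am : antimorphism A B;
  opp_ma : antimorphism B A;
  opp_amK : cancel opp_am opp_ma;
  opp_maK : cancel opp_ma opp_am
}.

Definition opposite_sym R (A B : algebra R) (d : opposite A B) : opposite B A :=
  Opposite (opp_maK d) (opp_amK d).

Section Duality.
Variables (R : comPzRingType) (E : lmodType R) (A B : algebra R).
Variable d : opposite A B.

Local Notation D := (Dmod (opp_am d) E).
Local Notation D' := (Dmod (opp_ma d) E).

Section Ev.
Variable M : lmodType A.

Fact ev_subproof (x : M) r (f g : D M) :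
  (alg_map B r *: f + g : D M) x = r *: (f x) + g x.
Proof. by rewrite dualE -(dualZ f) -(amR (opp_am d)). Qed.

Definition ev_fun (x : M) : D' (D M) :=
    @Dual R B E (D M) (fun f => f x) (ev_subproof x).

Fact ev_linear : linear ev_fun.
Proof.
move=> a x y; apply: dual_ext => f; apply: etrans (dualD f _ _) _.
by rewrite -[a in LHS](opp_maK d).
Qed.

Definition ev : {linear M -> D' (D M)} := mklin ev_linear.

End Ev.

Section Flip.
Variables (M : lmodType A) (N : lmodType B) (g : {linear M -> D' N}).

Fact flip_subproof n r (x y : M) : g (alg_map A r *: x + y) n = r *: g x n + g y n.
Proof.
rewrite linearP dualE; congr (_ + _).
by rewrite dual_scaleE (amR (opp_ma d)) dualZ.
Qed.

Definition flip_fun (n : N) : D M :=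
    @Dual R A E M (fun x => g x n) (flip_subproof n).

Fact flip_linear : linear flip_fun.
Proof.
move=> b n n'; apply: dual_ext => x; apply: etrans (dualD (g x) _ _) _.
congr (_ + _); change (g x (b *: n) = g (opp_am d b *: x) n).
by rewrite linearZ dual_scaleE opp_amK.
Qed.

(** The adjunction between Hom(M, D' N) and Hom(N, D M); the inverse direction is [flip] for
    [opposite_sym]. *)
Definition flip : {linear N -> D M} := mklin flip_linear.

Lemma flipE n x : flip n x = g x n. Proof. by []. Qed.

End Flip.
End Duality.

Section ExactDual.
Variables (R : comPzRingType) (E : lmodType R) (A B : algebra R).
Variables (s : antimorphism A B) (iE : injective_module E).

Lemma Dmap_inj (M N : lmodType A) (f : {linear M -> N}) :
  surjective_map f -> injective (Dmap s E f).
Proof.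
move=> sf g h e; apply: dual_ext => y; have [x <-] := sf y.
exact: (congr1 (fun k : Dmod s E M => k x) e).
Qed.

Lemma Dmap_surj (M N : lmodType A) (f : {linear M -> N}) :
  injective f -> surjective_map (Dmap s E f).
Proof.
move=> fi g; have [h hP] := iE (f := res_map f) (dual_to_res g) fi.
by exists (dual_of_res h); apply: dual_ext => x; apply: hP.
Qed.

Lemma Dmap_exact (K M N : lmodType A) (i : {linear K -> M}) (p : {linear M -> N}) :
  surjective_map p -> exact_at i p -> exact_at (Dmap s E p) (Dmap s E i).
Proof.
move=> sp ex f; split=> [f0|[g <-]]; last first.
  apply: dual_ext => k; rewrite !DmapE (_ : p (i k) = 0) ?dual0 //.
  by apply/ex; exists k.
have [m pm|g gP] := @factor_surj _ _ _ _ (res_map p) (dual_to_res f) sp.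
  have [k <-] := (ex m).1 pm; exact: (congr1 (fun h : Dmod s E K => h k) f0).
by exists (dual_of_res g); apply: dual_ext => x; apply: gP.
Qed.

End ExactDual.

Section FiniteDual.
Variables (R : comPzRingType) (E : lmodType R) (artR : artinian R).
Hypothesis mE : maximal_thin E.

Lemma Dmod_len (A B : algebra R) (s : antimorphism A B) l (M : lmodType A) :
  len_le l (res M) -> len_le l (res (Dmod s E M)).
Proof.
move=> h; have hl := len_Hom mE.1 h.
have lf : linear ((fun f => @Dual R (id_algebra R) E (res M) f (dualP f)) :
    res (Dmod s E M) -> Dmod (id_antimorphism R) E (res M)).
  move=> r f g; apply: dual_ext => x.
  change (f (s (alg_map B r) *: (x : M)) + g x = f (alg_map A r *: (x : M)) + g x).
  by rewrite amR.
apply: (len_le_inj (i := mklin lf)) hl => f g e; apply: dual_ext => x.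
exact: (congr1 (fun h : Dmod (id_antimorphism R) E (res M) => h x) e).
Qed.

Lemma Dmod_fg (A B : algebra R) (s : antimorphism A B) (M : lmodType A) :
  fgmod M -> fgmod (Dmod s E M).
Proof.
by move=> /(res_len artR)[l /(Dmod_len s)/len_fgmod/fgmod_of_res].
Qed.

Variables (A B : algebra R) (d : opposite A B).

Lemma ev_inj (M : lmodType A) : injective (ev E d M).
Proof.
move=> x y e; apply/subr0_eq; apply: contrapT => xy0.
have [f] := @maximal_thin_cogenerator _ E (res M) (x - y) mE xy0.
apply; rewrite linearB.
have := congr1 (fun h : Dmod _ E (Dmod _ E M) => h (dual_of_res f)) e.
by rewrite /= => ->; rewrite subrr.
Qed.

(** Dualising twice does not raise the length, whereas a proper submodule has a smaller one: the
    injection [ev] cannot be proper. *)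
Lemma ev_surj (M : lmodType A) : fgmod M -> surjective_map (ev E d M).
Proof.
move=> fM; have [l lM] := res_len artR fM.
have [|/= k /asboolP hk mk] := @ex_minnP (fun k => `[< len_le k (res M) >]).
  by exists l; apply/asboolP.
have hD := Dmod_len (opp_ma d) (Dmod_len (opp_am d) hk).
apply: contrapT => ns; case: k hk mk hD => [|k] hk mk hD.
  by apply: ns => y; exists 0; exact: etrans (linear0 (ev E d M)) (esym (hD y)).
have /asboolP/mk := @len_le_proper _ _ _ _ (res_map (ev E d M)) (@ev_inj M) ns hD.
by rewrite ltnn.
Qed.

End FiniteDual.

(** * Vanishing of Ext *)

Section Ses.
Variable A : pzRingType.
Implicit Types I J K M N P Q X Y Z W : lmodType A.

Definition ses K M X (i : {linear K -> M}) (p : {linear M -> X}) : Prop :=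
  [/\ injective i, exact_at i p & surjective_map p].

Lemma ses_ker M X (p : {linear M -> X}) :
  surjective_map p -> ses (@ker_incl _ _ _ p) p.
Proof. by split=> // [|x]; [exact: ker_incl_inj | exact: ker_inclP]. Qed.

Lemma ses_coker K M (i : {linear K -> M}) : injective i ->
  exists X (p : {linear M -> X}), ses i p.
Proof.
by move=> ii; have [X [p [sp pP]]] := quot_ex (submod_range i); exists X, p.
Qed.

Lemma ses0 K M X (i : {linear K -> M}) (p : {linear M -> X}) k :
  ses i p -> p (i k) = 0.
Proof. by case=> _ ex _; apply/ex; exists k. Qed.

Lemma ses_inj K M X (i : {linear K -> M}) (p : {linear M -> X}) :
  ses i p -> injective i.
Proof. by case. Qed.

Lemma ses_exact K M X (i : {linear K -> M}) (p : {linear M -> X}) :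
  ses i p -> exact_at i p.
Proof. by case. Qed.

Lemma ses_surj K M X (i : {linear K -> M}) (p : {linear M -> X}) :
  ses i p -> surjective_map p.
Proof. by case. Qed.

Lemma ses_lift K M X (i : {linear K -> M}) (p : {linear M -> X}) W
    (f : {linear W -> M}) : ses i p -> (forall w, p (f w) = 0) ->
  exists g : {linear W -> K}, forall w, i (g w) = f w.
Proof. by case=> ii ex _ pf; apply: factor_inj => // w; apply/ex. Qed.

Lemma ses_desc K M X (i : {linear K -> M}) (p : {linear M -> X}) W
    (f : {linear M -> W}) : ses i p -> (forall k, f (i k) = 0) ->
  exists g : {linear X -> W}, forall m, g (p m) = f m.
Proof. by case=> _ ex sp fi; apply: factor_surj => // m /ex[k <-]. Qed.

(** M is the preimage of X' in P. When P is projective, M is both a syzygy of X'' and an extension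
    of X' by the syzygy K of X. *)
Lemma ses_ker_comp K P X' X X'' (j : {linear K -> P}) (q : {linear P -> X})
    (i : {linear X' -> X}) (p : {linear X -> X''}) : ses j q -> ses i p ->
  exists M (a : {linear M -> X'}) (b : {linear K -> M}) (c : {linear M -> P}),
    [/\ ses b a, ses c (p \o q) & forall x, c (b x) = j x].
Proof.
move=> sP s; pose pq : {linear P -> X''} := p \o q.
have spq : surjective_map pq.
  by move=> x; have [y <-] := ses_surj s x; have [z <-] := ses_surj sP y; exists z.
have [M [c sM]] : exists M (c : {linear M -> P}), ses c pq.
  by exists (ker pq), (@ker_incl _ _ _ pq); apply: ses_ker.
have [x|a aP] := @ses_lift _ _ _ _ _ _ (q \o c) s; first exact: (ses0 x sM).
have [z|b bP] := @ses_lift _ _ _ _ _ _ j sM.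
  by rewrite /pq /= (ses0 _ sP) linear0.
exists M, a, b, c; split=> //; split=> [x y /(congr1 c)|y|y].
- by rewrite !bP => /(ses_inj sP).
- split=> [ay|[x <-]]; last by apply: (ses_inj s);
  rewrite aP /= bP (ses0 _ sP) linear0.
  have /(ses_exact sP)[x xP] : q (c y) = 0 by have := aP y;
    rewrite ay linear0 => /esym.
  by exists x; apply: (ses_inj sM); rewrite bP.
- have [z zy] := ses_surj sP (i y).
  have /(ses_exact sM)[x xz] : pq z = 0 by rewrite /pq /= zy (ses0 _ s).
  by exists x; apply: (ses_inj s); rewrite aP /= xz.
Qed.

Lemma isomorphic_inv M N : isomorphic M N ->
  exists (f : {linear M -> N}) (g : {linear N -> M}), cancel f g /\ cancel g f.
Proof.
move=> [f fb]; have [g' fK gK] := fb.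
have [w|g gP] := @factor_inj _ _ _ _ f (idfun : {linear N -> N}) (can_inj fK).
  by exists (g' w); rewrite gK.
by exists f, g; split=> // x; apply: (can_inj fK); rewrite gP.
Qed.

Lemma isomorphic_of_inv M N (f : {linear M -> N}) (g : {linear N -> M}) :
  cancel f g -> cancel g f -> isomorphic M N.
Proof. by move=> fK gK; exists f, g. Qed.

Lemma isomorphic_inj_surj M N (f : {linear M -> N}) :
  injective f -> surjective_map f -> isomorphic M N.
Proof.
move=> fi sf; exists f; have [g gP] := choice sf.
by exists g => x; [apply: fi; rewrite gP | rewrite gP].
Qed.

Lemma isomorphic_sym M N : isomorphic M N -> isomorphic N M.
Proof. by move=> /isomorphic_inv[f [g [fK gK]]]; exists g, f. Qed.

Definition syz1 X K : Prop := exists P (i : {linear K -> P}) (p : {linear P -> X}),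
  projective P /\ ses i p.

(* Ext^1(X, Y) = 0, on some projective presentation of X. *)
Definition ext1 X Y : Prop :=
  exists K P (i : {linear K -> P}) (p : {linear P -> X}),
  [/\ projective P, ses i p &
      forall f : {linear K -> Y}, exists g :
        {linear P -> Y}, forall x, g (i x) = f x].

(** The presentation on which [ext1] was tested covers the given sequence: M is a quotient of P x K,
    and the extension is glued from f on K and from a map u on P that agrees with f on the overlap
    K0. *)
Lemma ext1_extend X Y K M (i : {linear K -> M}) (p : {linear M -> X})
    (f : {linear K -> Y}) : ext1 X Y -> ses i p ->
  exists g : {linear M -> Y}, forall x, g (i x) = f x.
Proof.
move=> [K0 [P [i0 [p0 [pP s0 e0]]]]] s.
have [t tP] := pP _ _ p p0 (ses_surj s).
have [k|c cP] := @ses_lift _ _ _ _ _ _ (t \o i0) s.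
  by rewrite /= tP (ses0 _ s0).
have [u uP] := e0 (f \o c).
have lpi : linear (fun z : P * K => t z.1 + i z.2).
  by move=> a x y; rewrite !linearP scalerDr addrACA.
have lph : linear (fun z : P * K => u z.1 + f z.2).
  by move=> a x y; rewrite !linearP scalerDr addrACA.
have [m|[q k] /= e|g gP] := @factor_surj _ _ _ _ (mklin lpi) (mklin lph).
- have [x0 x0P] := ses_surj s0 (p m); have [k kP] : exists k, i k = m - t x0.
    by apply/(ses_exact s); rewrite linearB tP x0P subrr.
  by exists (x0, k); rewrite /= kP addrC subrK.
- have [k0 k0q] : exists k0, i0 k0 = q.
    apply/(ses_exact s0 _); rewrite -tP; have := congr1 p e.
    by rewrite linearD (ses0 _ s) addr0 linear0.
  have -> : k = - c k0.
    apply: (ses_inj s); rewrite linearN cP /= k0q; apply/eqP.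
    by rewrite -addr_eq0 addrC; apply/eqP.
  by rewrite -k0q uP /= linearN subrr.
by exists g => x; have := gP (0, x); rewrite /= !linear0 !add0r.
Qed.

Lemma ext1_lift X Y N Z (j : {linear Y -> N}) (q : {linear N -> Z})
    (f : {linear X -> Z}) : ext1 X Y -> ses j q ->
  exists g : {linear X -> N}, forall x, q (g x) = f x.
Proof.
move=> [K0 [P [i0 [p0 [pP s0 e0]]]]] s.
have [h hP] := pP _ _ q (f \o p0) (ses_surj s).
have [k|c cP] := @ses_lift _ _ _ _ _ _ (h \o i0) s.
  by rewrite /= hP /= (ses0 _ s0) linear0.
have [u uP] := e0 c.
have [k|g gP] := @ses_desc _ _ _ _ _ _ (h \- (j \o u)) s0.
  by rewrite /= uP cP subrr.
exists g => x; have [y <-] := ses_surj s0 x.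
by rewrite gP /= linearB (ses0 _ s) subr0 hP.
Qed.

(** A map from the syzygy to Y extends to P with values in N. The induced map X -> Z lifts to N, and
    subtracting this lift brings the values back into Y. *)
Lemma ext1_of_lift X Y N Z (j : {linear Y -> N}) (q : {linear N -> Z}) :
  ses j q -> ext1 X N ->
  (forall f : {linear X -> Z}, exists g :
    {linear X -> N}, forall x, q (g x) = f x) ->
  ext1 X Y.
Proof.
move=> s [K0 [P [i0 [p0 [pP s0 e0]]]]] hl; exists K0, P, i0, p0; split=> // f.
have [g gP] := e0 (j \o f).
have [k|h hP] := @ses_desc _ _ _ _ _ _ (q \o g) s0.
  by rewrite /= gP (ses0 _ s).
have [h' h'P] := hl h.
have [x|u uP] := @ses_lift _ _ _ _ _ _ (g \- (h' \o p0)) s.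
  by rewrite /= linearB h'P hP subrr.
exists u => x; apply: (ses_inj s).
by rewrite uP /= (ses0 _ s0) linear0 subr0 gP.
Qed.

Lemma ext1_inj X K I : injective_module I -> syz1 X K -> ext1 X I.
Proof.
move=> iI [P [i [p [pP s]]]]; exists K, P, i, p; split=> // f.
by have [g gP] := iI _ _ i f (ses_inj s); exists g.
Qed.

(* The identity of X is, modulo maps factoring through projectives, a retract
   of Z: a relation preserved by syzygies, whatever the projective
   presentations. *)
Definition stable_retract X Z : Prop :=
  exists (i : {linear X -> Z}) (r : {linear Z -> X})
    Q (u : {linear X -> Q}) (v : {linear Q -> X}),
  projective Q /\ forall x, x = r (i x) + v (u x).

Lemma stable_retract_of_retract X Z (i : {linear X -> Z}) (r : {linear Z -> X}) :
  cancel i r -> stable_retract X Z.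
Proof.
move=> ir; exists i, r, 'rV[A]_0, \0%R, \0%R; split; first exact: projective_rV.
by move=> x; rewrite ir addr0.
Qed.

Lemma stable_retract_iso X Z : isomorphic X Z -> stable_retract X Z.
Proof. by move=> /isomorphic_inv[f [g [fK _]]];
  apply: stable_retract_of_retract fK. Qed.

(** The lifts [al] and [be] of i and r compose to the identity of P up to the term that lifts v u
    and a remainder that dies in X; this remainder is the map s into K. *)
Lemma stable_retract_lift X Z K P (i0 : {linear K -> P}) (p0 : {linear P -> X})
    K' P' (i0' : {linear K' -> P'}) (p0' : {linear P' -> Z}) :
  stable_retract X Z -> projective P -> ses i0 p0 -> projective P' -> ses i0' p0' ->
  exists (al : {linear P -> P'}) (a : {linear K -> K'}) (b : {linear K' -> K})
    (s : {linear P -> K}),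
  (forall k, i0' (a k) = al (i0 k)) /\ forall k, k = b (a k) + s (i0 k).
Proof.
move=> [i [r [Q [u [v [pQ e]]]]]] pP s pP' s'.
have [al alP] := pP _ _ p0' (i \o p0) (ses_surj s').
have [be beP] := pP' _ _ p0 (r \o p0') (ses_surj s).
have [w wP] := pQ _ _ p0 v (ses_surj s).
have [k|a aP] := @ses_lift _ _ _ _ _ _ (al \o i0) s'.
  by rewrite /= alP /= (ses0 _ s) linear0.
have [k|b bP] := @ses_lift _ _ _ _ _ _ (be \o i0') s.
  by rewrite /= beP /= (ses0 _ s') linear0.
have [x|t tP] := @ses_lift _ _ _ _ _ _
    (idfun \- (be \o al) \- (w \o u \o p0)) s.
  by rewrite /= !linearB wP beP /= alP /= {1}(e (p0 x)) -addrA -opprD subrr.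
exists al, a, b, t; split=> // k; apply: (ses_inj s).
by rewrite linearD tP /= (ses0 _ s) !linear0 addr0 bP /= aP addrC subrK.
Qed.

Lemma stable_retract_syz1 X Z K K' :
  stable_retract X Z -> syz1 X K -> syz1 Z K' -> stable_retract K K'.
Proof.
move=> h [P [i [p [pP s]]]] [P' [i' [p' [pP' s']]]].
have [al [a [b [t [_ e]]]]] := stable_retract_lift h pP s pP' s'.
by exists a, b, P, i, t.
Qed.

Lemma ext1_stable_retract X Z K Y :
  stable_retract X Z -> syz1 X K -> ext1 Z Y -> ext1 X Y.
Proof.
move=> h [P [i [p [pP s]]]] [K' [P' [i' [p' [pP' s' e']]]]].
have [al [a [b [t [e1 e2]]]]] := stable_retract_lift h pP s pP' s'.
exists K, P, i, p; split=> // f; have [g gP] := e' (f \o b).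
exists ((g \o al) \+ (f \o t)) => k.
by rewrite /= -e1 gP {3}(e2 k) linearD.
Qed.

(* The index is shifted: ext k X Y says that Ext^(k+1)(X, Y) = 0. *)
Fixpoint ext (k : nat) X Y : Prop :=
  match k with
  | 0 => ext1 X Y
  | j.+1 => exists K, syz1 X K /\ ext j K Y
  end.

Lemma ext_retract_r k X Y Y' (i : {linear Y -> Y'}) (r : {linear Y' -> Y}) :
  cancel i r -> ext k X Y' -> ext k X Y.
Proof.
move=> ir; elim: k X => [|k IH] X; last by move=> [K [s /IH h]]; exists K.
move=> [K [P [j [p [pP s h]]]]]; exists K, P, j, p; split=> // f.
by have [g gP] := h (i \o f); exists (r \o g) => x; rewrite /= gP /= ir.
Qed.

Lemma ext_iso_r k X Y Y' : isomorphic Y Y' -> ext k X Y -> ext k X Y'.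
Proof. by move=> /isomorphic_inv[f [g [_ gK]]]; apply: ext_retract_r gK. Qed.

Lemma ext_rV k X m : ext k X A^o -> ext k X 'rV[A]_m.
Proof.
elim: k X => [|k IH] X; last by move=> [K [s /IH h]]; exists K.
move=> [K [P [j [p [pP s h]]]]]; exists K, P, j, p; split=> // f.
have lf i : linear (fun x => f x 0 i : A^o) by move=> a x y; rewrite linearP !mxE.
have /choice[g gP] i := h (mklin (lf i)).
have lg : linear (fun x => \row_i (g i x : A)).
  by move=> a x y; apply/rowP => i; rewrite !mxE linearP.
by exists (mklin lg) => x; apply/rowP => i; rewrite /= mxE gP.
Qed.

Lemma ext_syz1_first k X K Y : syz1 X K -> ext k K Y -> ext k.+1 X Y.
Proof. by move=> s h; exists K. Qed.

Lemma projective_split P M (p : {linear M -> P}) :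
  projective P -> surjective_map p -> exists s : {linear P -> M}, cancel s p.
Proof. by move=> pP sp; have [s h] := pP _ _ p idfun sp; exists s. Qed.

Lemma injective_split I M (i : {linear I -> M}) :
  injective_module I -> injective i -> exists r : {linear M -> I}, cancel i r.
Proof. by move=> iI ii; have [s h] := iI _ _ i idfun ii; exists s. Qed.

Lemma projective_retract P Q (i : {linear P -> Q}) (r : {linear Q -> P}) :
  cancel i r -> projective Q -> projective P.
Proof.
move=> ir pQ M N f g sf; have [h hP] := pQ _ _ f (g \o r) sf.
by exists (h \o i) => x; rewrite /= hP /= ir.
Qed.

Lemma injective_retract I J (i : {linear I -> J}) (r : {linear J -> I}) :
  cancel i r -> injective_module J -> injective_module I.
Proof.
move=> ir iJ M N f g fi; have [h hP] := iJ _ _ f (i \o g) fi.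
by exists (r \o h) => x; rewrite /= hP /= ir.
Qed.

Lemma ext_proj_r k X Q : fgmod Q -> projective Q -> ext k X A^o -> ext k X Q.
Proof.
move=> /fgmodP[m [p sp]] pQ /(ext_rV m).
by have [s] := projective_split pQ sp; apply: ext_retract_r.
Qed.

End Ses.

(** * Dimension shifting and pieces of the long exact sequences *)

Section ExtAlgebra.
Variables (R : comPzRingType) (A : algebra R) (artR : artinian R).
Implicit Types K M N P Q X Y Z W I : lmodType A.

Definition fsyz1 X K : Prop := exists P (i : {linear K -> P}) (p : {linear P -> X}),
  [/\ fgmod P, projective P & ses i p].

Lemma fsyz1_syz1 X K : fsyz1 X K -> syz1 X K.
Proof. by move=> [P [i [p [fP pP s]]]]; exists P, i, p. Qed.

Lemma fsyz1_fg X K : fsyz1 X K -> fgmod X /\ fgmod K.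
Proof.
move=> [P [i [p [fP pP s]]]]; split.
  exact: fgmod_surj (ses_surj s) fP.
exact: (fgmod_inj artR (ses_inj s) fP).
Qed.

Lemma fsyz1_ex X : fgmod X -> exists K, fsyz1 X K.
Proof.
move=> /fgmodP[m [p sp]]; exists (ker p), 'rV[A]_m, (@ker_incl _ _ _ p), p.
by split; [exact: fgmod_rV | exact: projective_rV | exact: ses_ker].
Qed.

Lemma ext_stable_retract k X Z Y :
  fgmod X -> stable_retract X Z -> ext k Z Y -> ext k X Y.
Proof.
elim: k X Z => [|k IH] X Z fX h; have [K sK] := fsyz1_ex fX.
  exact: (ext1_stable_retract h (fsyz1_syz1 sK)).
move=> [K' [sK' e]]; exists K; split; first exact: fsyz1_syz1.
apply: (IH _ K') => //; first by case: (fsyz1_fg sK).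
exact: stable_retract_syz1 h (fsyz1_syz1 sK) sK'.
Qed.

Lemma ext_iso_l k X X' Y : fgmod X -> isomorphic X X' -> ext k X' Y -> ext k X Y.
Proof. by move=> fX /stable_retract_iso; apply: ext_stable_retract. Qed.

(** X is a stable retract of itself, so any two syzygies of X are stable retracts of each other: the
    one provided by [ext] can be replaced by K. *)
Lemma extS k X K Y : fsyz1 X K -> ext k.+1 X Y <-> ext k K Y.
Proof.
move=> sK; have [fX fK] := fsyz1_fg sK; have sK1 := fsyz1_syz1 sK.
split=> [[K' [sK' e]]|]; last exact: ext_syz1_first.
apply: ext_stable_retract e => //; apply: stable_retract_syz1 sK1 sK'.
exact: (@stable_retract_of_retract _ _ _ idfun idfun).
Qed.

Lemma ext_inj_r k X I : fgmod X -> injective_module I -> ext k X I.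
Proof.
elim: k X => [|k IH] X fX iI; have [K sK] := fsyz1_ex fX.
  exact: ext1_inj (fsyz1_syz1 sK).
by apply/(extS _ _ sK)/IH => //; case: (fsyz1_fg sK).
Qed.

Lemma ext_ses_quot k X Y' Y Y'' (j : {linear Y' -> Y}) (q : {linear Y -> Y''}) :
  fgmod X -> ses j q -> ext k X Y -> ext k.+1 X Y' -> ext k X Y''.
Proof.
move=> + s; elim: k X => [|k IH] X fX; have [K sK] := fsyz1_ex fX; last first.
  move=> /(extS _ _ sK) h /(extS _ _ sK) h'; apply/(extS _ _ sK).
  by apply: IH h h'; case: (fsyz1_fg sK).
move=> e /(extS _ _ sK) e'; have [P [i [p [fP pP sP]]]] := sK.
exists K, P, i, p; split=> // f; have [g gP] := ext1_lift f e' s.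
have [h hP] := ext1_extend g e sP.
by exists (q \o h) => x; rewrite /= hP gP.
Qed.

Lemma ext_ses_sub k X Y' Y Y'' (j : {linear Y' -> Y}) (q : {linear Y -> Y''}) :
  fgmod X -> ses j q -> ext k X Y'' -> ext k.+1 X Y -> ext k.+1 X Y'.
Proof.
move=> + s; elim: k X => [|k IH] X fX; have [K sK] := fsyz1_ex fX; last first.
  move=> /(extS _ _ sK) h /(extS _ _ sK) h'; apply/(extS _ _ sK).
  by apply: IH h h'; case: (fsyz1_fg sK).
move=> e /(extS _ _ sK) e'; apply/(extS _ _ sK).
apply: (ext1_of_lift s e') => f; have [P [i [p [fP pP sP]]]] := sK.
have [g gP] := ext1_extend f e sP; have [h hP] := pP _ _ q g (ses_surj s).
by exists (h \o i) => x; rewrite /= hP gP.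
Qed.

Lemma ext_shift k X Y I Y' (j : {linear Y -> I}) (q : {linear I -> Y'}) :
  fgmod X -> injective_module I -> ses j q -> ext k.+1 X Y <-> ext k X Y'.
Proof.
move=> fX iI s; split=> h.
  by apply: (ext_ses_quot fX s) => //; apply: ext_inj_r.
by apply: (ext_ses_sub fX s) => //; apply: ext_inj_r.
Qed.

Definition enough_injectives : Prop := forall X, fgmod X ->
  exists I Y (i : {linear X -> I}) (p : {linear I -> Y}),
  [/\ fgmod I, injective_module I, fgmod Y & ses i p].

Hypothesis enough_inj : enough_injectives.

(** The index is lowered by shifting Y along an injective, which leaves the sequence unchanged;
    shifting on the left would require fitting the three syzygies into a sequence. *)
Lemma ext_ses_mid k X' X X'' Y (i : {linear X' -> X}) (p : {linear X -> X''}) :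
  fgmod X -> fgmod Y -> ses i p -> ext k X' Y -> ext k X'' Y -> ext k X Y.
Proof.
move=> fX + s; have fX' := fgmod_inj artR (ses_inj s) fX.
have fX'' := fgmod_surj (ses_surj s) fX.
elim: k Y => [|k IH] Y fY e' e''; last first.
  have [I [Z [j [q [fI iI fZ sZ]]]]] := enough_inj fY.
  apply/(ext_shift k fX iI sZ); apply: IH => //.
    exact/(ext_shift k fX' iI sZ).
  exact/(ext_shift k fX'' iI sZ).
have [K [P [j [q [fP pP sK]]]]] := fsyz1_ex fX; exists K, P, j, q; split=> // f.
have [M [a [b [c [sba sM cb]]]]] := ses_ker_comp sK s.
have [g gP] := ext1_extend f e' sba; have [h hP] := ext1_extend g e'' sM.
by exists h => x; rewrite -cb hP gP.
Qed.

(* P -> X -> X'' turns the sequence into an extension of X' by the syzygy of X. *)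
Lemma ext_ses_right k X' X X'' Y (i : {linear X' -> X}) (p : {linear X -> X''}) :
  fgmod X -> fgmod Y -> ses i p -> ext k X' Y -> ext k.+1 X Y -> ext k.+1 X'' Y.
Proof.
move=> fX fY s e' e; have [K sK] := fsyz1_ex fX.
have [P [j [q [fP pP sP]]]] := sK; move/(extS _ _ sK) in e.
have [M [a [b [c [sba sM _]]]]] := ses_ker_comp sP s.
have sX'' : fsyz1 X'' M by exists P, c, (p \o q).
apply/(extS _ _ sX''); have [_ fM] := fsyz1_fg sX''.
exact: ext_ses_mid sba e e'.
Qed.

End ExtAlgebra.

Section DualInjective.
Variables (R : comPzRingType) (E : lmodType R).
Hypothesis iE : injective_module E.

(** D' makes a surjection out of the injective f, and [flip] turns extension along f into lifting
    from Q along this surjection. *)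
Lemma Dmod_injective (A B : algebra R) (d : opposite A B) (Q : lmodType A) :
  projective Q -> injective_module (Dmod (opp_am d) E Q).
Proof.
move=> pQ M N f g fi.
have [h hP] := pQ _ _ (Dmap (opp_ma d) E f)
  (flip (d := opposite_sym d) g) (Dmap_surj (s := opp_ma d) iE fi).
exists (flip (d := d) h) => x; apply: dual_ext => y.
exact: (congr1 (fun k : Dmod (opp_ma d) E M => k x) (hP y)).
Qed.

Lemma Dses (A B : algebra R) (s : antimorphism A B) (K M N : lmodType A)
    (i : {linear K -> M}) (p : {linear M -> N}) :
  ses i p -> ses (Dmap s E p) (Dmap s E i).
Proof.
move=> [ii ex sp]; split; [exact: Dmap_inj | exact: Dmap_exact | exact: Dmap_surj].
Qed.

End DualInjective.

Section ArtinAlgebra.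
Variables (R : comPzRingType) (E : lmodType R) (artR : artinian R).
Hypothesis mE : maximal_thin E.

Let iE : injective_module E := maximal_thin_injective mE.

Lemma ev_iso (A B : algebra R) (d : opposite A B) (M : lmodType A) :
  fgmod M -> isomorphic M (Dmod (opp_ma d) E (Dmod (opp_am d) E M)).
Proof.
move=> fM; apply: (isomorphic_inj_surj (f := ev E d M)).
  exact: (ev_inj mE (d := d)).
exact: (ev_surj artR mE (d := d)).
Qed.

(** The dual of a projective presentation of X embeds D X in an injective with cokernel D K, and
    [flip] exchanges extending a map K -> D' Y with lifting a map Y -> D K. *)
Lemma ext_dual (A B : algebra R) (d : opposite A B) k (X : lmodType A) (Y :
    lmodType B) :
  fgmod X -> fgmod Y ->
  ext k X (Dmod (opp_ma d) E Y) -> ext k Y (Dmod (opp_am d) E X).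
Proof.
move=> + fY; elim: k X => [|k IH] X fX; have [K sK] := fsyz1_ex fX.
  move=> e; have [P [i [p [fP pP s]]]] := sK.
  have [L sL] := fsyz1_ex fY.
  apply: (ext1_of_lift (Dses iE (opp_am d) s)).
    exact: ext1_inj (Dmod_injective iE pP) (fsyz1_syz1 sL).
  move=> f; have [g gP] := ext1_extend (flip (d := opposite_sym d) f) e s.
  exists (flip (d := d) g) => y; apply: dual_ext => x.
  by rewrite DmapE flipE gP.
move=> /(extS artR _ _ sK)/IH h; have [P [i [p [fP pP s]]]] := sK.
apply/(ext_shift artR k fY (Dmod_injective iE pP) (Dses iE (opp_am d) s)).
by apply: h; case: (fsyz1_fg artR sK).
Qed.

Lemma ext_dualE (A B : algebra R) (d : opposite A B) k (X : lmodType A) (Y :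
    lmodType B) :
  fgmod X -> fgmod Y ->
  ext k X (Dmod (opp_ma d) E Y) <-> ext k Y (Dmod (opp_am d) E X).
Proof.
move=> fX fY; split; first exact: ext_dual.
exact: (ext_dual (d := opposite_sym d)).
Qed.

Section Injectives.
Variables (A B : algebra R) (d : opposite A B).
Implicit Types I J K M N P Q X Y Z W : lmodType A.

Let cofree m : lmodType A := Dmod (opp_ma d) E 'rV[B]_m.

Lemma cofree_inj m : injective_module (cofree m).
Proof. exact: (Dmod_injective iE (d := opposite_sym d) (@projective_rV _ _)). Qed.

Lemma cofree_fg m : fgmod (cofree m).
Proof. exact: (Dmod_fg artR mE _ (fgmod_rV _ _)). Qed.

Lemma cofree_embed X : fgmod X -> exists m (i :
    {linear X -> cofree m}), injective i.
Proof.
move=> fX; have /fgmodP[m [q sq]] := Dmod_fg artR mE (opp_am d) fX.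
exists m, (Dmap (opp_ma d) E q \o ev E d X) => x y /(Dmap_inj sq).
exact: (ev_inj mE (d := d)).
Qed.

Lemma inj_embed X : fgmod X -> exists I (i : {linear X -> I}),
  [/\ fgmod I, injective_module I & injective i].
Proof.
move=> /cofree_embed[m [i ii]]; exists (cofree m), i.
by split; [exact: cofree_fg | exact: cofree_inj | ].
Qed.

Lemma enough_injectives_algebra : enough_injectives A.
Proof.
move=> X /inj_embed[I [i [fI iI ii]]]; have [Y [p s]] := ses_coker ii.
by exists I, Y, i, p; split=> //; apply: fgmod_surj (ses_surj s) fI.
Qed.

End Injectives.
End ArtinAlgebra.

(** * Resolutions and injective dimension *)

Section Resolutions.
Variable A : pzRingType.
Implicit Types I J K M N P Q X Y Z W : lmodType A.

(** The types of the maps depend on the chosen modules, hence the nested [cid]. *)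
Lemma ses_choice (T : Type) (K X : T -> lmodType A) (F : T -> lmodType A -> Prop) :
  (forall t, exists P (i : {linear K t -> P}) (p : {linear P -> X t}),
    F t P /\ ses i p) ->
  exists (P : T -> lmodType A) (i : forall t, {linear K t -> P t})
    (p : forall t, {linear P t -> X t}), forall t, F t (P t) /\ ses (i t) (p t).
Proof.
move=> h; exists (fun t => sval (cid (h t))),
  (fun t => sval (cid (svalP (cid (h t))))),
  (fun t => sval (cid (svalP (cid (svalP (cid (h t))))))) => t.
exact: svalP (cid (svalP (cid (svalP (cid (h t)))))).
Qed.

Lemma ses_comp_exact K M X M' X' (i : {linear K -> M}) (p : {linear M -> X})
    (i' : {linear X -> M'}) (p' : {linear M' -> X'}) N
    (j : {linear X' -> N}) :
  ses i p -> ses i' p' -> injective j -> exact_at (i' \o p) (j \o p').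
Proof.
move=> s s' ji y; split=> [|[x <-]]; last by rewrite /= (ses0 _ s') linear0.
move=> e; have /(ses_exact s')[x <-] : p' y = 0 by apply: ji; rewrite linear0.
by have [m <-] := ses_surj s x; exists m.
Qed.

Section Syzygies.
Variables (X : lmodType A) (R : proj_resolution X).

(** Indexed so that every term of the resolution sits in a sequence from syzygy k + 1 to syzygy k,
    the augmentation included. *)
Definition pr_syz (k : nat) : lmodType A :=
  match k with 0 => X | 1 => ker (pr_aug R) | j.+2 => ker (pr_diff R j) end.

Definition pr_incl k : {linear pr_syz k.+1 -> pr_obj R k} :=
  match k with 0 => @ker_incl _ _ _ (pr_aug R) | j.+1 => @ker_incl _ _ _
    (pr_diff R j) end.

Fact pr_aug_diff x : pr_aug R (pr_diff R 0 x) = 0.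
Proof. by apply/(@pr_exact0 _ _ R _); exists x. Qed.

Fact pr_diffK k x : pr_diff R k (pr_diff R k.+1 x) = 0.
Proof. by apply/(@pr_exact _ _ R k _); exists x. Qed.

Definition pr_proj k : {linear pr_obj R k -> pr_syz k} :=
  match k with
  | 0 => pr_aug R
  | 1 => ker_corestr pr_aug_diff
  | j.+2 => ker_corestr (@pr_diffK j)
  end.

Lemma pr_incl_proj k x : pr_incl k (pr_proj k.+1 x) = pr_diff R k x.
Proof. by case: k x. Qed.

Lemma pr_ses k : ses (pr_incl k) (pr_proj k).
Proof.
case: k => [|[|k]].
- exact: (ses_ker (@pr_aug_surj _ _ R)).
- split=> [|y|y]; first exact: ker_incl_inj.
    rewrite -ker_inclP; split=> [/(congr1 (@ker_incl _ _ _ (pr_aug R)))//|e].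
    exact: ker_incl_inj.
  have /(@pr_exact0 _ _ R _)[x e] : pr_aug R (ker_incl y) = 0
    by apply/ker_inclP; exists y.
  by exists x; apply: ker_incl_inj.
- split=> [|y|y]; first exact: ker_incl_inj.
    rewrite -ker_inclP; split=> [/(congr1 (@ker_incl _ _ _ (pr_diff R k)))//|e].
    exact: ker_incl_inj.
  have /(@pr_exact _ _ R k _)[x e] : pr_diff R k (ker_incl y) = 0
    by apply/ker_inclP; exists y.
  by exists x; apply: ker_incl_inj.
Qed.

(** A cocycle vanishes on the next image, so it is a map on the syzygy; it is a coboundary when that
    map extends to the projective containing the syzygy. *)
Lemma pr_cocycleP k Y :
  (forall f : {linear pr_obj R k.+1 -> Y}, (forall x, f (pr_diff R k.+1 x) = 0) ->
     exists g : {linear pr_obj R k -> Y}, forall x, f x = g (pr_diff R k x)) <->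
  (forall f : {linear pr_syz k.+1 -> Y},
     exists g : {linear pr_obj R k -> Y}, forall x, g (pr_incl k x) = f x).
Proof.
split=> [h f|h f f0].
  have [x|g gP] := h (f \o pr_proj k.+1).
    by rewrite -pr_incl_proj /= (ses0 _ (pr_ses k.+1)) linear0.
  exists g => x; have [y <-] := ses_surj (pr_ses k.+1) x.
  by rewrite pr_incl_proj -gP.
have [z|f' f'P] := @ses_desc _ _ _ _ _ _ _ f (pr_ses k.+1).
  by have [y <-] := ses_surj (pr_ses k.+2) z; rewrite pr_incl_proj.
by have [g gP] := h f'; exists g => x; rewrite -f'P -gP pr_incl_proj.
Qed.

Lemma pr_ext k Y :
  (forall f : {linear pr_syz k.+1 -> Y},
     exists g : {linear pr_obj R k -> Y}, forall x, g (pr_incl k x) = f x) ->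
  ext k X Y.
Proof.
move=> h; suff e m j : (j + m = k)%N -> ext m (pr_syz j) Y by apply: (e k 0%N).
elim: m j => [|m IH] j; first rewrite addn0 => ->.
  exists (pr_syz k.+1), (pr_obj R k), (pr_incl k), (pr_proj k).
  by split; [exact: pr_projective | exact: pr_ses | exact: h].
rewrite addnS -addSn => /IH; apply: ext_syz1_first.
exists (pr_obj R j), (pr_incl j), (pr_proj j).
by split; [exact: pr_projective | exact: pr_ses].
Qed.

End Syzygies.
End Resolutions.

Section ExtVanishes.
Variables (R : comPzRingType) (A : algebra R) (artR : artinian R).
Implicit Types I J K M N P Q X Y Z W : lmodType A.

Lemma fg_proj_resolution X : fgmod X ->
  exists S : proj_resolution X, forall k, fgmod (pr_obj S k).
Proof.
move=> fX.
have next (Z : {Z : lmodType A | fgmod Z}) : exists K : {Z :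
  lmodType A | fgmod Z}, fsyz1 (sval Z) (sval K).
  case: Z => Z fZ; have [K sK] := fsyz1_ex fZ.
  by have [_ fK] := fsyz1_fg artR sK; exists (exist _ K fK).
have [f fP] := choice next.
pose Z k := sval (iter k f (exist _ X fX)).
have [t|P [i [p h]]] :=
  @ses_choice A nat (fun k => Z k.+1) Z (fun _ P => fgmod P /\ projective P).
  by have [P [i [p [fg pP s]]]] := fP (iter t f (exist _ X fX)); exists P, i, p.
have s k := (h k).2.
have e0 : exact_at (i 0%N \o p 1%N) (p 0%N).
  exact: (@ses_comp_exact _ _ _ _ _ _ _ _ _ _ _ idfun (s 1%N) (s 0%N)).
have e k : exact_at (i k.+1 \o p k.+2) (i k \o p k.+1).
  exact: ses_comp_exact (s k.+2) (s k.+1) (ses_inj (s k)).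
by exists (ProjResolution (fun k => (h k).1.2) (ses_surj (s 0%N)) e0 e) => k;
  case: (h k).1.
Qed.

Lemma Ext_vanishesP k X Y : fgmod X -> Ext_vanishes k.+1 X Y <-> ext k X Y.
Proof.
move=> fX; split=> [[S /pr_cocycleP]|e]; first exact: pr_ext.
have [S fS] := fg_proj_resolution fX; exists S; apply/pr_cocycleP => f.
have sS j : fsyz1 (pr_syz S j) (pr_syz S j.+1).
  exists (pr_obj S j), (pr_incl S j), (pr_proj S j).
  by split; [exact: fS | exact: pr_projective | exact: pr_ses].
have e1 : ext1 (pr_syz S k) Y.
  have h m j : (j + m = k)%N -> ext k X Y -> ext m (pr_syz S j) Y.
    elim: j m => [|j IH] m; first by rewrite add0n => ->.
    by rewrite addSn -addnS => /IH h' /h' /(extS artR _ _ (sS j)).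
  by apply: (h 0%N k _ e); rewrite addn0.
exact: ext1_extend f e1 (pr_ses S k).
Qed.

Lemma trivial_injective I : trivial_module I -> injective_module I.
Proof.
move=> tI M N f g fi; exists \0%R => x.
by rewrite (tI (g x)).
Qed.

Lemma finite_injective_dimension_ext Y : finite_injective_dimension Y ->
  exists d, forall k X, (d <= k)%N -> fgmod X -> ext k X Y.
Proof.
move=> [d [S tS]]; pose Z j : lmodType A := ker (ir_diff S j).
have dK j x : ir_diff S j.+1 (ir_diff S j x) = 0
  by apply/(@ir_exact _ _ S j _); exists x.
have sZ j : ses (@ker_incl _ _ _ (ir_diff S j)) (ker_corestr (dK j)).
  split=> [|y|y]; first exact: ker_incl_inj.
    rewrite -ker_inclP; split=> [/(congr1 (@ker_incl _ _ _ (ir_diff S j.+1)))//|e].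
    exact: ker_incl_inj.
  have /(@ir_exact _ _ S j _)[x e] : ir_diff S j.+1 (ker_incl y) = 0
    by apply/ker_inclP; exists y.
  by exists x; apply: ker_incl_inj.
have YZ : isomorphic Y (Z 0%N).
  have d0 x : ir_diff S 0 (ir_coaug S x) = 0 by apply/(@ir_exact0 _ _ S _);
    exists x.
  apply: (isomorphic_inj_surj (f := ker_corestr d0)).
    by move=> x y /(congr1 (@ker_incl _ _ _ (ir_diff S 0))) /(@ir_coaug_inj _ _ S).
  move=> y; have /(@ir_exact0 _ _ S _)[x e] : ir_diff S 0 (ker_incl y) = 0
    by apply/ker_inclP; exists y.
  by exists x; apply: ker_incl_inj.
have tZ : trivial_module (Z d.+1).
  by move=> x; apply: ker_incl_inj; rewrite linear0; apply: tS.
(* The zero cosyzygy is Z (d + 1), which sits inside the zero term of index d + 1. *)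
exists d.+1 => k X dk fX; apply: (ext_iso_r (isomorphic_sym YZ)).
suff e m j l : (m + j = d.+1)%N -> ext (m + l)%N X (Z j).
  by rewrite -(subnKC dk); apply: e; rewrite addn0.
elim: m j => [|m IH] j; first rewrite add0n => ->.
  exact: (ext_inj_r artR _ fX (trivial_injective tZ)).
rewrite addSn -addnS => /IH e; rewrite addSn.
exact/(ext_shift artR _ fX (@ir_injective _ _ S j) (sZ j)).
Qed.

Hypothesis enough_inj : enough_injectives A.

Lemma finite_injective_dimension_of_ext X d : fgmod X ->
  (forall Y, fgmod Y -> ext d Y X) -> finite_injective_dimension X.
Proof.
move=> fX hd.
(* Once a cosyzygy Z is injective, the next step must take I = Z and Z' = 0, so that the resolution
   stops; the last clause records this. *)
pose good Z I Z' := [/\ fgmod I, injective_module I &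
  injective_module Z -> trivial_module Z' /\ (trivial_module Z ->
    trivial_module I)].
have next (Z : {Z : lmodType A | fgmod Z}) : exists Z' : {Z :
  lmodType A | fgmod Z}, exists I
    (i : {linear sval Z -> I}) (p : {linear I -> sval Z'}),
    good (sval Z) I (sval Z') /\ ses i p.
  case: Z => Z fZ /=; have [iZ|nZ] := pselect (injective_module Z); last first.
    have [I [Y [i [p [fI iI fY s]]]]] := enough_inj fZ.
    by exists (exist _ Y fY), I, i, p; split=> //.
  have t0 (x : 'rV[A]_0) : x = 0 by apply/rowP => -[].
  exists (exist _ ('rV[A]_0 : lmodType A) (fgmod_rV A 0)), Z, idfun, \0%R;
    split; first by split.
  split=> [//|y|y]; last by exists 0; rewrite (t0 y).
  by split=> // _; exists y.
have [f fP] := choice next.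
pose Z k := sval (iter k f (exist _ X fX)).
have [t|I [i [p h]]] :=
  @ses_choice A nat Z (fun k => Z k.+1) (fun k I => good (Z k) I (Z k.+1)).
  exact: fP.
have s k := (h k).2; have fZ k : fgmod (Z k) by apply: svalP.
have iI k : injective_module (I k) by case: (h k) => [[]].
have eZ j l Y : (j + l = d)%N -> fgmod Y -> ext l Y (Z j).
  move=> + fY; elim: j l => [|j IH] l; first by rewrite add0n => ->; apply: hd.
  by rewrite addSn -addnS => /IH e; apply/(ext_shift artR _ fY (iI j) (s j)).
(* Ext^1(Z (d + 1), Z d) vanishes, so Z d is a summand of the injective I d. *)
have iZ : injective_module (Z d).
  have [r rP] := ext1_extend idfun (eZ d 0%N (Z d.+1) (addn0 d) (fZ _)) (s d).
  exact: injective_retract rP (iI d).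
have tZ k : (d < k)%N -> trivial_module (Z k).
  elim: k => // k IH; rewrite ltnS leq_eqVlt => /predU1P[dk|/IH/trivial_injective].
    by case: (h k) => [[_ _]]; rewrite -dk => /(_ iZ)[].
  by case: (h k) => [[_ _ h' _ /h'[]]].
have e0 : exact_at (i 0%N) (i 1%N \o p 0%N).
  move=> y; rewrite -(ses_exact (s 0%N)); split=> [|e];
    last by rewrite /= e linear0.
  by move=> e; apply: (ses_inj (s 1%N)); rewrite linear0.
have e k : exact_at (i k.+1 \o p k) (i k.+2 \o p k.+1).
  exact: ses_comp_exact (s k) (s k.+1) (ses_inj (s k.+2)).
exists d, (InjResolution iI (ses_inj (s 0%N)) e0 e) => k dk /=.
have [[_ _ hk] _] := h k; have [_ tI] := hk (trivial_injective (tZ _ dk)).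
exact/tI/tZ.
Qed.

End ExtVanishes.

(** * Projective covers and injective envelopes *)

Section Minimal.
Variables (R : comPzRingType) (A : algebra R) (artR : artinian R).
Implicit Types I J K M N P Q S T X Y Z W : lmodType A.

(* A minimal submodule U of A^m with p(U) = X is a retract of A^m: a lift A^m -> U
   of p restricts to a surjective, hence bijective, endomorphism of U. *)
Lemma projective_cover_ex X : fgmod X ->
  exists P (p : {linear P -> X}), projective_cover p.
Proof.
move=> /fgmodP[m [p0 sp0]]; have [l hl] := fgmod_len artR (fgmod_rV A m).
have [||U [[sU Up] mU]] := submod_min
  (P := fun U => submod U /\ forall x, exists u, U u /\ p0 u = x) hl.
- by move=> U [].
- exists (fun=> True); split=> // x; have [u <-] := sp0 x; by exists u.
have [P [i [ii iU]]] := sub_ex sU; pose p : {linear P -> X} := p0 \o i.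
have sp : surjective_map p.
  by move=> x; have [u [/iU[y <-] <-]] := Up x; exists y.
have min N (g : {linear N -> P}) : surjective_map (p \o g) -> surjective_map g.
  move=> sg y; have [|||k e] := mU (fun u => exists k, (i \o g) k = u) _ _ (i y).
  - split; first exact: (submod_range (i \o g : {linear N -> 'rV_m})).
    by move=> x; have [k <-] := sg x; exists (i (g k)); split=> //; exists k.
  - by move=> _ [k <-]; apply/iU; exists (g k).
  - by apply/iU; exists y.
  - by exists k; apply: ii.
have [h hP] := @projective_rV _ m _ _ p p0 sp.
have lP : len_le l P := len_le_inj ii hl.
have he : surjective_map (h \o i).
  by apply: min => x; have [y <-] := sp x; exists y; apply: hP.
have hi : injective (h \o i : {linear P -> P}) := surj_endo_inj lP he.
have [w|r rP] := @factor_inj _ _ _ _ (h \o i) h hi; first exact: he.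
exists P, p; split; last by split.
  exact: len_fgmod lP.
apply: (projective_retract (i := i) (r := r)) (@projective_rV _ _) => y.
by apply: hi; rewrite rP.
Qed.

Lemma projective_coverP P X (p : {linear P -> X}) :
  projective_cover p -> fsyz1 X (ker p).
Proof.
move=> [fP pP [sp _]]; exists P, (@ker_incl _ _ _ p), p; split=> //.
exact: ses_ker.
Qed.

Hypothesis enough_inj : enough_injectives A.

(** Dividing I by a submodule U maximal among those meeting X in 0 gives an essential Q. A map Q ->
    I extending X -> I composes with I -> Q to an endomorphism that is injective by essentiality,
    hence bijective by length: Q is a retract of I. *)
Lemma injective_envelope_ex X : fgmod X ->
  exists I (i : {linear X -> I}), injective_envelope i.
Proof.
move=> /enough_inj[I [_ [i [_ [fI iI _ /ses_inj ii]]]]].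
have [l hl] := fgmod_len artR fI.
have [||U [[sU Ui] mU]] := submod_max
  (P := fun U => submod U /\ forall x, U (i x) -> x = 0) hl.
- by move=> U [].
- exists (fun x => x = 0); split; last by move=> x e; apply: ii; rewrite linear0.
  exact: submod0.
have [Q [q [sq qU]]] := quot_ex sU; pose j : {linear X -> Q} := q \o i.
have ij : injective j.
  move=> x y e; apply/subr0_eq/Ui/qU; rewrite linearB linearB.
  by apply/eqP; rewrite subr_eq0; apply/eqP.
have ess N (g : {linear Q -> N}) : injective (g \o j) -> injective g.
  move=> ig; suff g0 z : g z = 0 -> z = 0.
    by move=> x y e; apply/subr0_eq/g0; rewrite linearB e subrr.
  have [y <-] := sq z => gy; apply/qU; apply: (mU (fun u => g (q u) = 0)) gy.
  - split; last by move=> x e; apply: ig; rewrite /= e !linear0.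
    by split=> [|a x x' e e'];
      [rewrite !linear0 | rewrite !linearP e e' scaler0 addr0].
  - by move=> u /qU ->; rewrite linear0.
have [h hP] := iI _ _ j i ij; pose e : {linear Q -> Q} := q \o h.
have ie : injective e by apply: ess => x y; rewrite /e /= !hP; apply: ij.
have fQ : fgmod Q := fgmod_surj sq fI.
have [l' hl'] := fgmod_len artR fQ.
have [w|r rP] := @factor_inj _ _ _ _ e q ie; first exact: inj_endo_surj hl' ie _.
exists Q, j; split=> //; apply: (injective_retract (i := h) (r := r)) iI => z.
by apply: ie; rewrite rP.
Qed.

Lemma is_syzygy_ex m X : fgmod X -> exists K, is_syzygy m X K.
Proof.
move=> fX; suff [K [h _]] : exists K, is_syzygy m X K /\ fgmod K by exists K.
elim: m => [|m [Y [h fY]]]; first by exists X; split=> //; exists idfun; exists id.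
have [P [p pc]] := projective_cover_ex fY; exists (ker p); split.
  by exists Y, P, p; split=> //; exists idfun; exists id.
by case: (fsyz1_fg artR (projective_coverP pc)).
Qed.

Lemma is_cosyzygy_ex m X : fgmod X -> exists K, is_cosyzygy m X K.
Proof.
move=> fX; suff [K [h _]] : exists K, is_cosyzygy m X K /\ fgmod K by exists K.
elim: m => [|m [Y [h fY]]]; first by exists X; split=> //; exists idfun; exists id.
have [I [i ic]] := injective_envelope_ex fY; have [fI iI [ii _]] := ic.
have [K [c s]] := ses_coker ii; exists K; split.
  by exists Y, I, i, c; split=> //; [exact: ses_surj s | exact: ses_exact s].
exact: fgmod_surj (ses_surj s) fI.
Qed.

Lemma isomorphic_fg M N : isomorphic M N -> fgmod M -> fgmod N.
Proof.
move=> /isomorphic_inv[f [g [_ gK]]]; apply: (fgmod_surj (p := f)) => x.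
by exists (g x).
Qed.

Lemma is_syzygy_ext m X K : is_syzygy m X K -> fgmod X ->
  fgmod K /\ forall k W, ext (m + k)%N X W <-> ext k K W.
Proof.
elim: m K => [|m IH] K.
  move=> iKX fX; have iXK := isomorphic_sym iKX; have fK := isomorphic_fg iXK fX.
  by split=> // k W; split; apply: ext_iso_l.
move=> [Y [P [p [/IH{}IH /projective_coverP s iK]]]] /IH[fY e].
have iK' := isomorphic_sym iK; have [_ fk] := fsyz1_fg artR s.
have fK := isomorphic_fg iK' fk.
split=> // k W; rewrite addSn -addnS e (extS artR _ _ s).
by split; apply: ext_iso_l.
Qed.

Lemma is_cosyzygy_ext m X K : is_cosyzygy m X K -> fgmod X ->
  fgmod K /\ forall k W, fgmod W -> ext (m + k)%N W X <-> ext k W K.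
Proof.
elim: m K => [|m IH] K.
  move=> iKX fX; have iXK := isomorphic_sym iKX; have fK := isomorphic_fg iXK fX.
  by split=> // k W fW; split; apply: ext_iso_r.
move=> [Y [I [i [c [/IH{}IH [fI iI [ii _]] sc ex]]]]] /IH[fY e].
split=> [|k W fW]; first exact: fgmod_surj sc fI.
have s : ses i c by split.
by rewrite addSn -addnS e // (ext_shift artR k fW iI s).
Qed.

Lemma ext_proj_l k P Y : projective P -> ext k P Y.
Proof.
move=> pP; have s Q : projective Q -> ses (\0%R :
  {linear 'rV[A]_0 -> Q}) (idfun : {linear Q -> Q}).
  move=> _; split=> [x y _|y|y]; last by exists y.
    by apply/rowP => -[].
  by split=> [y0|[x <-]]; [exists 0; exact: esym y0 | ].
elim: k P pP => [|k IH] P pP.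
  exists 'rV[A]_0, P, \0%R, idfun; split=> // [|f]; first exact: s.
  exists \0%R => x /=; have -> : x = 0 by apply/rowP => -[].
  by rewrite linear0.
exists 'rV[A]_0; split; last exact/IH/projective_rV.
by exists P, \0%R, idfun; split=> //; apply: s.
Qed.

Lemma ext1_projective W :
    fgmod W -> (forall Y, fgmod Y -> ext1 W Y) -> projective W.
Proof.
move=> fW h; have [K sK] := fsyz1_ex fW; have [_ fK] := fsyz1_fg artR sK.
have [P [i [p [_ pP s]]]] := sK; have [g gP] := ext1_lift idfun (h _ fK) s.
exact: projective_retract gP pP.
Qed.

End Minimal.

(** * From a bound for each module to a uniform bound *)

Section UniformBound.
Variables (R : comPzRingType) (A : algebra R) (artR : artinian R).
Implicit Types I J K M N P Q S T X Y Z W : lmodType A.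
Hypothesis enough_inj : enough_injectives A.

Lemma simple_or_zero_fg S : simple_or_zero S -> fgmod S.
Proof. by move=> /len_le1/len_fgmod. Qed.

Lemma simple_or_zero_surj M S (f : {linear M -> S}) m :
  simple_or_zero S -> f m <> 0 -> surjective_map f.
Proof. by move=> sS fm y; have [r ->] := sS _ y fm; exists (r *: m);
  rewrite linearZ. Qed.

(** A simple quotient of M is a quotient of [ker g] or isomorphic to S1, so only finitely many
    bounds have to be combined along the filtration. *)
Lemma simple_bound Y l M :
  (forall X, fgmod X -> exists d, forall k, (d <= k)%N -> ext k X Y) ->
  len_le l M ->
  exists d, forall S (f : {linear M -> S}) m, simple_or_zero S -> f m <> 0 ->
    forall k, (d <= k)%N -> ext k S Y.
Proof.
move=> h; elim: l M => [|l IH] M.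
  by move=> tM; exists 0%N => S f m _; rewrite (tM m) linear0.
move=> [S1 [g [sS1 /IH[d1 h1]]]].
have [d2 h2] := h _ (simple_or_zero_fg sS1).
exists (maxn d1 d2) => S f m sS fm k; rewrite geq_max => /andP[k1 k2].
have [[z fz]|nz] := pselect (exists z, f (@ker_incl _ _ _ g z) <> 0).
  exact: (h1 S (f \o @ker_incl _ _ _ g) z).
have f0 x : g x = 0 -> f x = 0.
  by move=> /ker_inclP[z <-]; apply: contrapT => fz; apply: nz; exists z.
have gm : g m <> 0 by move=> /f0.
have sg := simple_or_zero_surj sS1 gm; have [f' f'P] := factor_surj sg f0.
apply: (ext_iso_l artR (simple_or_zero_fg sS)) (h2 _ k2).
apply: isomorphic_sym; apply: (isomorphic_inj_surj (f := f')); last first.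
  by apply: (@simple_or_zero_surj _ _ _ (g m)) => //; rewrite f'P.
move=> x y e; apply/subr0_eq; apply: contrapT => xy; apply: fm.
have [r e'] := sS1 _ (g m) xy.
by rewrite -f'P e' linearZ /= linearB e subrr scaler0.
Qed.

(** Every simple module is a quotient of the regular one, so a single bound serves them all;
    extensions carry it to all modules of finite length. *)
Lemma ext_uniform_bound Y : fgmod Y ->
  (forall X, fgmod X -> exists d, forall k, (d <= k)%N -> ext k X Y) ->
  exists d, forall X k, fgmod X -> (d <= k)%N -> ext k X Y.
Proof.
move=> fY h.
have [l /(simple_bound h)[d hd]] := fgmod_len artR (fgmod_regular A).
have hS S k : simple_or_zero S -> (d <= k)%N -> ext k S Y.
  move=> sS dk; have [[s s0]|nz] := pselect (exists s : S, s <> 0).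
    by apply: (hd S (scaler_map s) 1) => //=; rewrite scale1r.
  apply: ext_proj_l => M N f g _; exists \0%R => x.
  have -> : x = 0 by apply: contrapT => x0; apply: nz; exists x.
  by rewrite !linear0.
exists d => X k fX dk; have [l' hl] := fgmod_len artR fX.
elim: l' X fX hl => [|l' IH] X fX.
  move=> tX; apply: hS => // x y; by rewrite (tX x).
move=> [S [g [sS kg]]]; have fk : fgmod (ker g) by apply: len_fgmod kg.
have [[x gx]|nz] := pselect (exists x, g x <> 0).
  apply: (ext_ses_mid artR enough_inj fX fY (ses_ker (simple_or_zero_surj sS
    gx))); last exact: hS.
  exact: IH.
apply: (ext_iso_l artR fX) (IH _ fk kg); apply: isomorphic_sym.
apply: (isomorphic_inj_surj (f := @ker_incl _ _ _ g)); first exact: ker_incl_inj.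
by move=> x; apply/ker_inclP; apply: contrapT => gx; apply: nz; exists x.
Qed.

End UniformBound.

(** * Cluster tilting classes *)

Section ClusterTilting.
Variables (R : comPzRingType) (A : algebra R) (artR : artinian R).
Implicit Types I J K M N P Q S T X Y Z W : lmodType A.
Hypothesis enough_inj : enough_injectives A.

Variables (n : nat) (C : lmodType A -> Prop).

(* The kernels of successive right C-approximations end up in C. *)
Lemma ext_bound_of_C Y : fgmod Y ->
  (forall X, C X -> fgmod X) -> (forall m, C 'rV[A]_m) ->
  contravariantly_finite C ->
  (forall X, C X <-> fgmod X /\ forall T, C T -> forall i,
    (i.+1 < n)%N -> ext i T X) ->
  (forall X, C X -> exists d, forall k, (d <= k)%N -> ext k X Y) ->
  forall X, fgmod X -> exists d, forall k, (d <= k)%N -> ext k X Y.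
Proof.
move=> fY Cfg CP Ccf CE CY X fX.
(* The summand n is generalised to j, the number of approximations still to be made: the condition
   is void for j = n and says that X is in C for j = 0. *)
have : forall T, C T -> forall i, (i.+1 + n < n)%N -> ext i T X.
  by move=> T _ i; rewrite ltnNge leq_addl.
move: {1}n => j; elim: j X fX => [|j IH] X fX hX.
  by apply/CY/CE; split=> // T CT i; move=> lt; apply: hX; rewrite ?addn0.
have [T [f [CT fP]]] := Ccf X fX.
have sf : surjective_map f.
  have /fgmodP[m [p sp]] := fX; have [h hP] := fP _ p (CP m).
  by move=> x; have [v <-] := sp x; exists (h v); rewrite hP.
have s := ses_ker sf; have fK := fgmod_inj artR (ses_inj s) (Cfg _ CT).
have orth T' i : C T' -> (i.+1 < n)%N -> ext i T' T.
  by move=> CT'; case/CE: CT => _; apply.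
have [T' CT' i lt|d1 h1] := IH (ker f) fK.
  have lt' : (i.+1 < n)%N by apply: leq_ltn_trans lt; rewrite leq_addr.
  case: i lt lt' => [|i] lt lt'.
    apply: (ext1_of_lift s); first exact: (orth T' 0%N).
    by move=> g; have [h hP] := fP _ g CT'; exists h => x; rewrite hP.
  apply: (ext_ses_sub artR (Cfg _ CT') s); last exact: orth.
  by apply: hX => //; rewrite addnS -addSn.
have [d2 h2] := CY _ CT; exists (maxn d1 d2).+1 => -[|k] //.
rewrite ltnS geq_max => /andP[k1 k2].
apply: (ext_ses_right artR enough_inj (Cfg _ CT) fY s); first exact: h1.
by apply: h2; apply: leq_trans k2 _.
Qed.

(* Over a Gorenstein algebra these are the Gorenstein projective modules. *)
Definition gproj X : Prop := fgmod X /\ forall k, ext k X A^o.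

Lemma gproj_proj X Q k : gproj X -> fgmod Q -> projective Q -> ext k X Q.
Proof. by move=> [_ h] fQ pQ; apply: ext_proj_r. Qed.

Lemma gproj_syz X : gproj X -> exists K, fsyz1 X K /\ gproj K.
Proof.
move=> [fX eX]; have [K s] := fsyz1_ex fX; exists K; split=> //.
by split=> [|k]; [case: (fsyz1_fg artR s) | apply/(extS artR _ _ s)].
Qed.

(** Induction on the bound m for the projective dimension of W, which drops by one on a syzygy. *)
Lemma gproj_finite_pd G m W : gproj G -> fgmod W ->
  (forall Y, fgmod Y -> ext m W Y) -> forall k, ext k G W.
Proof.
move=> gG; elim: m W => [|m IH] W fW eW k.
  exact: gproj_proj gG fW (ext1_projective artR fW eW).
have [K s] := fsyz1_ex fW; have [_ fK] := fsyz1_fg artR s.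
have eK := IH K fK (fun Y fY => (extS artR _ _ s).1 (eW Y fY)).
have [P [i [p [fP pP sP]]]] := s.
by apply: (ext_ses_quot artR gG.1 sP); [exact: gproj_proj | exact: eK].
Qed.

(** The values at the generators of G embed Hom(G, A) in a finitely generated R-module; the
    components of f are generators of Hom(G, A) over R. *)
Lemma left_approximation G : fgmod G -> exists m (f : {linear G -> 'rV[A]_m}),
  forall g : {linear G -> A^o},
    exists u : {linear 'rV[A]_m -> A^o}, forall x, g x = u (f x).
Proof.
move=> /fgmodP[t [p sp]].
pose U (v : res 'rV[A]_t) := exists g : {linear G -> A^o},
  v = \row_i (g (p (delta_mx 0 i)) : A).
have sU : submod U.
  split=> [|r _ _ [g ->] [h ->]].
    by exists \0%R; apply/rowP => i; rewrite !mxE.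
  have lk : linear (fun x => alg_map A r * g x + h x : A^o).
    move=> a x y; rewrite !linearP scalerDr addrACA mulrDr; congr (_ + _ + _).
    by rewrite [LHS]mulrA alg_central -mulrA.
  by exists (mklin lk); apply/rowP => i; rewrite !mxE.
have [K [i [ii iU]]] := sub_ex sU.
have [l hl] := res_len artR (fgmod_rV A t).
have [m [e eP]] := len_fgmod (len_le_inj ii hl).
have /choice[g gP] j : U (i (e j)) by apply/iU; exists (e j).
have lf : linear (fun x => \row_j (g j x : A)).
  by move=> a x y; apply/rowP => j; rewrite !mxE linearP.
exists m, (mklin lf) => h.
have [k kP] : exists k, i k = \row_i (h (p (delta_mx 0 i)) : A) by apply/iU;
  exists h.
have [c kE] := eP k.
have lu : linear (fun w : 'rV[A]_m => \sum_j w 0 j * alg_map A (c j) : A^o).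
  move=> a v w; rewrite scaler_sumr -big_split; apply: eq_bigr => j _ /=.
  by rewrite !mxE mulrDl -mulrA.
exists (mklin lu) => x; have [v <-] := sp x.
have hd s : h (p (delta_mx 0 s)) = \sum_j g j (p (delta_mx 0 s)) * alg_map A (c
  j) :> A.
  have := congr1 (fun w : 'rV[A]_t => w 0 s) kP; rewrite !mxE => <-.
  rewrite kE linear_sum summxE; apply: eq_bigr => j _.
  by rewrite linearZ gP /= res_scaleE !mxE alg_central.
rewrite (row_sum_delta v) !linear_sum /=.
apply: eq_bigr => s _; rewrite !linearZ /= hd scaler_sumr; apply: eq_bigr => j _.
by rewrite !mxE !linearZ /= [LHS]mulrA.
Qed.

Hypothesis pd_inj : exists d, forall k I Y, (d <= k)%N ->
  fgmod I -> injective_module I -> fgmod Y -> ext k I Y.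

(* An embedding of G in an injective I lifts to a free cover of I, whose kernel
   has finite projective dimension; a left approximation by free modules is then injective
   and has cokernel orthogonal to A. *)
Lemma gproj_cosyz G : gproj G -> exists X, fsyz1 X G /\ gproj X.
Proof.
move=> gG; have [fG eG] := gG.
have [I [_ [i [_ [fI iI _ /ses_inj ii]]]]] := enough_inj fG.
have [d hd] := pd_inj.
have [P [j ij]] : exists P (j :
  {linear G -> P}), [/\ fgmod P, projective P & injective j].
  have [K s] := fsyz1_ex fI; have [_ fK] := fsyz1_fg artR s.
  have [P [i' [p' [fP pP s']]]] := s.
  have eK := gproj_finite_pd (m := d) gG fK
    (fun Y fY => (extS artR _ _ s).1 (hd d.+1 I Y (leqnSn d) fI iI fY)).
  have [g gP] := ext1_lift i (eK 0%N) s'; exists P, g; split=> // x y e.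
  by apply: ii; rewrite -!gP e.
case: ij => fP pP ij.
have [m [f fP']] := left_approximation fG.
(* The coordinates of an embedding of G in a free module all factor through f. *)
have fi : injective f.
  have /fgmodP[t [q sq]] := fP; have [s sK] := projective_split pP sq.
  move=> x y e; apply: ij; apply: (can_inj sK); apply/rowP => k.
  have lc : linear (fun x => s (j x) 0 k : A^o) by move=> a u v;
    rewrite !linearP !mxE.
  by have [u uP] := fP' (mklin lc); rewrite -[LHS]/(mklin lc x) uP e -uP.
have [X [p s]] := ses_coker fi.
have sX : fsyz1 X G by exists 'rV[A]_m, f, p; split=> //;
  [exact: fgmod_rV | exact: projective_rV].
exists X; split=> //; split=> [|[|k]]; first by case: (fsyz1_fg artR sX).
  exists G, 'rV[A]_m, f, p; split=> //; first exact: projective_rV.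
  by move=> h; have [u uP] := fP' h; exists u.
exact/(extS artR _ _ sX).
Qed.

Lemma gproj_family G : gproj G -> exists Z : int -> lmodType A,
  [/\ Z 0 = G, forall i, gproj (Z i) & forall i, fsyz1 (Z (i + 1)) (Z i)].
Proof.
move=> gG.
have nextL (X : {X : lmodType A | gproj X}) : exists K : {X :
  lmodType A | gproj X}, fsyz1 (sval X) (sval K).
  by case: X => X gX; have [K [s gK]] := gproj_syz gX; exists (exist _ K gK).
have nextR (K : {X : lmodType A | gproj X}) : exists X : {X :
  lmodType A | gproj X}, fsyz1 (sval X) (sval K).
  by case: K => K gK; have [X [s gX]] := gproj_cosyz gK; exists (exist _ X gX).
have [f fP] := choice nextL; have [g gP] := choice nextR.
pose G0 : {X : lmodType A | gproj X} := exist _ G gG.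
(* [Negz k] stands for -(k + 1), hence the extra iteration. *)
pose Z (i : int) := match i with Posz k => iter k g G0 | Negz k => iter k.+1 f
  G0 end.
exists (fun i => sval (Z i)); split=> // [i|i]; first exact: svalP.
case: i => [k|[|k]]; first by rewrite -[Posz k + 1]/(Posz (k + 1)) addn1; apply: gP.
- exact: fP.
- have -> : Negz k.+1 + 1 = Negz k by rewrite !NegzE -addn1 PoszD opprD subrK.
  exact: fP.
Qed.

(** Unlike [is_syzygy], allows arbitrary presentations: the complete resolutions built from
    approximations need not be minimal. *)
Fixpoint fsyzn (m : nat) X K : Prop :=
  match m with 0 => K = X | j.+1 => exists Y, fsyz1 X Y /\ fsyzn j Y K end.

Lemma fsyzn_ex m X : fgmod X -> exists K, fsyzn m X K.
Proof.
elim: m X => [|m IH] X fX; first by exists X.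
have [Y s] := fsyz1_ex fX; have [_ /IH[K sK]] := fsyz1_fg artR s.
by exists K, Y.
Qed.

Lemma fsyzn_ext m X K k W : fsyzn m X K -> ext (m + k)%N X W <-> ext k K W.
Proof.
elim: m X => [|m IH] X; first by move=> ->.
by move=> [Y [s /IH <-]]; rewrite addSn (extS artR _ _ s).
Qed.

Lemma fsyzn_fg m X K : fsyzn m X K -> fgmod X -> fgmod K.
Proof.
elim: m X => [|m IH] X; first by move=> ->.
by move=> [Y [s /IH h]] _; apply: h; case: (fsyz1_fg artR s).
Qed.

Lemma family_fsyzn (Z : int -> lmodType A) m j :
  (forall i, fsyz1 (Z (i + 1)) (Z i)) -> fsyzn m (Z (j + m%:Z)) (Z j).
Proof.
move=> h; elim: m => [|m IH]; first by rewrite addr0.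
exists (Z (j + m%:Z)); split=> //.
by rewrite -addn1 PoszD addrA; apply: h.
Qed.

Hypothesis n_gt0 : (0 < n)%N.
Hypothesis CE : forall X, C X <->
  fgmod X /\ forall T, C T -> forall i, (i.+1 < n)%N -> ext i X T.
Hypothesis Corth : forall X Y, C X -> C Y -> forall i,
  ~~ (n %| i.+1)%N -> ext i X Y.

Lemma C_fg X : C X -> fgmod X. Proof. by move=> /CE[]. Qed.

(** Ext^i(K, T) is Ext^(m+i)(X, T), and n does not divide m + i when 0 < i < n. Asking only for the
    shift of Ext lets this serve both [is_syzygy] and [fsyzn]. *)
Lemma C_syzygy X K m : C X -> fgmod K -> (n %| m)%N ->
  (forall k W, ext (m + k)%N X W <-> ext k K W) -> C K.
Proof.
move=> CX fK nm e; apply/CE; split=> // T CT i lt; apply/e/Corth => //.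
by rewrite -addnS dvdn_addr // gtnNdvd.
Qed.

(** Ext from W into projectives vanishes, so the second argument can also be shifted along its
    syzygies. *)
Lemma gproj_ext_syzygy W T m K k : gproj W -> fgmod T -> fsyzn m T K ->
  ext (m + k)%N W K -> ext k W T.
Proof.
move=> gW; elim: m T k => [|m IH] T k fT; first by move=> ->.
move=> [Y [s sY]]; rewrite addSnnS => e; have [_ fY] := fsyz1_fg artR s.
have [P [i [p [fP pP sP]]]] := s; apply: (ext_ses_quot artR gW.1 sP).
  exact: gproj_proj.
exact: IH sY e.
Qed.

(* Both arguments are shifted n times: Ext^i(X, T) is Ext^i(G, Omega^n T). *)
Lemma C_cosyzygy G X : C G -> gproj X -> fsyzn n X G -> C X.
Proof.
move=> CG gX s; apply/CE; split=> [|T CT i lt]; first exact: gX.1.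
have [K sK] := fsyzn_ex n (C_fg CT).
have CK : C K.
  apply: (C_syzygy CT (fsyzn_fg sK (C_fg CT)) (dvdnn n)) => k W.
  exact: fsyzn_ext.
apply: (gproj_ext_syzygy gX (C_fg CT) sK); apply/(fsyzn_ext _ _ s)/Corth => //.
by rewrite gtnNdvd.
Qed.

Lemma C_family (Z : int -> lmodType A) : C (Z 0) -> (forall i, gproj (Z i)) ->
  (forall i, fsyz1 (Z (i + 1)) (Z i)) -> forall i : int, C (Z (i * n%:Z)).
Proof.
move=> C0 gZ sZ; elim/int_rec=> [|i IH|i IH]; first by rewrite mul0r.
  rewrite -addn1 PoszD mulrDl mul1r; apply: (C_cosyzygy IH) => //.
  exact: family_fsyzn.
apply: (C_syzygy IH (m := n)) => // [|k W]; first by case: (gZ (- i.+1%:Z * n%:Z)).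
apply: fsyzn_ext; have := family_fsyzn n (- i.+1%:Z * n%:Z) sZ.
by rewrite -{2}[n%:Z]mul1r -mulrDl -addn1 PoszD opprD subrK.
Qed.

Hypothesis id_reg : exists d, forall k X, (d <= k)%N -> fgmod X -> ext k X A^o.

Lemma C_gproj_syzygy X : C X -> exists i K,
  [/\ is_syzygy (i * n) X K, gproj K & C K].
Proof.
(* Any multiple of n that is at least d would do; d n is one because n is positive. *)
move=> CX; have [d hd] := id_reg; have fX := C_fg CX; exists d.
have [K sK] := is_syzygy_ex artR (d * n) fX;
  have [fK e] := is_syzygy_ext artR sK fX.
exists K; split=> //; last exact: C_syzygy CX fK (dvdn_mull d (dvdnn n)) e.
split=> // k; apply/e/hd => //; apply: leq_trans (leq_addr _ _).
by rewrite leq_pmulr.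
Qed.

End ClusterTilting.

(** * Totally acyclic complexes *)

Section Complexes.
Variable A : pzRingType.
Implicit Types I J K M N P Q X Y Z W : lmodType A.
Implicit Types cx : complex A.

Lemma acyclic_ses cx i : acyclic cx -> ses (cycles_incl cx i) (to_cycles cx i).
Proof.
move=> ac; split=> [|x|y]; first exact: ker_incl_inj.
  rewrite -ker_inclP; split=> [/(congr1 (@ker_incl _ _ _ (cx_diff cx (i +
    1))))//|e].
  exact: ker_incl_inj.
have /(ac i)[x e] : cx_diff cx (i + 1) (ker_incl y) = 0 by apply/ker_inclP;
  exists y.
by exists x; apply: ker_incl_inj.
Qed.

Lemma complex_of_family (Z : int -> lmodType A) (F : lmodType A -> Prop) :
  (forall j, exists P (i : {linear Z j -> P}) (p : {linear P -> Z (j + 1)}),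
     F P /\ ses i p) ->
  exists cx, [/\ acyclic cx, forall j, F (cx j) &
    forall j, isomorphic (Z j) (cycles cx j)].
Proof.
move=> /(ses_choice (X := fun j => Z (j + 1)) (F := fun=> F))[P [i [p h]]].
have s j := (h j).2.
have dK j x : (i (j + 1 + 1) \o p (j + 1)) ((i (j + 1) \o p j) x) = 0.
  by rewrite /= (ses0 _ (s (j + 1))) linear0.
pose cx := @Complex A P (fun j => i (j + 1) \o p j) dK.
have dE j x : cx_diff cx j x = 0 <-> exists z, i j z = x.
  rewrite -(ses_exact (s j)) /=; split=> [e|->]; last by rewrite linear0.
  by apply: (ses_inj (s (j + 1))); rewrite linear0.
exists cx; split=> [j|j|j]; last 1 first.
- have [z|g gP] := @factor_inj _ _ _ _ (cycles_incl cx j) (i j) (@ker_incl_inj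
  _ _ _ _).
    by apply/ker_inclP/dE; exists z.
  apply: (isomorphic_inj_surj (f := g)) => [x y /(congr1 (cycles_incl cx j))|y].
    by rewrite !gP => /(ses_inj (s j)).
  have /dE[z zP] : cx_diff cx j (cycles_incl cx j y) = 0 by apply/ker_inclP;
    exists y.
  by exists z; apply: ker_incl_inj; rewrite [LHS]gP zP.
- move=> y; rewrite dE; split=> [[z <-]|[x <-]]; last by exists (p j x).
  by have [x <-] := ses_surj (s j) z; exists x.
- by case: (h j).
Qed.

Lemma contra_hom_acyclic_fromI cx Q W k i (f : {linear W -> cx i}) :
  acyclic cx -> (forall j,
    ext1 (cycles cx (j + 1)) Q) -> exact_at f (cx_diff cx i) ->
  contra_hom_acyclic_from Q f (segment_tail cx k i).
Proof.
move=> ac e; elim: k W i f => [|k IH] W i f ex /=; have s := acyclic_ses i ac.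
  split=> [h|h h0 y]; last by have [x <-] := ses_surj s y; apply: h0.
  split=> [hf|[u hu] w]; last first.
    rewrite hu; have -> : to_cycles cx i (f w) = 0; last by rewrite linear0.
    by apply: ker_incl_inj; rewrite linear0; apply/ex; exists w.
  have [z|u uP] := ses_desc (f := h) s; last by exists u.
  have [w <-] : exists w, f w = cycles_incl cx i z by apply/ex/ker_inclP; exists z.
  exact: hf.
split; last exact: IH.
move=> h; split=> [hf|[u hu] w]; last first.
  by rewrite hu (_ : cx_diff cx i (f w) = 0) ?linear0 //; apply/ex; exists w.
have [z|u uP] := ses_desc (f := h) s.
  have [w <-] : exists w, f w = cycles_incl cx i z by apply/ex/ker_inclP; exists z.
  exact: hf.
have [v vP] := ext1_extend u (e (i + 1)) (acyclic_ses (i + 1) ac).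
by exists v => y; rewrite -uP -vP.
Qed.

Lemma contra_hom_acyclicI cx Q k i :
  acyclic cx -> (forall j, ext1 (cycles cx (j + 1)) Q) ->
  contra_hom_acyclic Q (cycles_incl cx i) (segment_tail cx k i).
Proof.
move=> ac e; split=> [h|].
  by have [u uP] := ext1_extend h (e i) (acyclic_ses i ac); exists u.
by apply: contra_hom_acyclic_fromI => // x; apply: ker_inclP.
Qed.

Lemma co_hom_acyclic_fromI cx J W k i (f : {linear W -> cx i}) :
  acyclic cx -> (forall j, ext1 J (cycles cx j)) ->
  co_hom_exact J f (cx_diff cx i) ->
  co_hom_acyclic_from J f (segment_tail cx k i).
Proof.
move=> ac e; elim: k W i f => [|k IH] W i f ex /=; have s := acyclic_ses i ac.
  split=> h; last by have [u uP] := ext1_lift h (e i) s; exists u => x; rewrite -uP.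
  rewrite -(ex h); split=> [h0 x|h0 x]; last by apply: ker_incl_inj;
    rewrite linear0; apply: h0.
  by have := congr1 (cycles_incl cx (i + 1)) (h0 x); rewrite linear0.
split=> //; apply: IH => h; split=> [h0|[u uP] x]; last by rewrite uP cx_diffK.
have [x|g gP] := @factor_inj _ _ _ _ (cycles_incl cx (i + 1)) h (@ker_incl_inj
  _ _ _ _).
  exact/ker_inclP.
by have [u uP] := ext1_lift g (e i) s; exists u => x; rewrite -gP -uP.
Qed.

Lemma co_hom_acyclicI cx J k i :
  acyclic cx -> (forall j, ext1 J (cycles cx j)) ->
  co_hom_acyclic J (cycles_incl cx i) (segment_tail cx k i).
Proof.
move=> ac e; split=> [h h0 x|]; first by apply: ker_incl_inj; rewrite linear0;
  apply: h0.
apply: co_hom_acyclic_fromI => // h; split=> [h0|[u uP] x].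
  have [x|u uP] := @factor_inj _ _ _ _ (cycles_incl cx i) h (@ker_incl_inj _ _ _ _).
    exact/ker_inclP.
  by exists u.
by rewrite uP; apply/ker_inclP; exists (u x).
Qed.

(** Composed with the projection onto the cycles, h kills the image of f; exactness factors the
    composite through the differential, and the factor extends h. The case t = 0 is the other half
    of [contra_hom_acyclic]. *)
Lemma contra_hom_acyclic_fromE cx Q W k i (f : {linear W -> cx i}) :
  acyclic cx -> exact_at f (cx_diff cx i) ->
  contra_hom_acyclic_from Q f (segment_tail cx k i) ->
  forall t, (0 < t <= k)%N -> forall h : {linear cycles cx (i + t%:Z) -> Q},
    exists u : {linear cx (i + t%:Z) -> Q}, forall x, u (cycles_incl cx _ x) = h x.
Proof.
move=> ac; elim: k W i f => [|k IH] W i f ex /=.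
  by move=> _ [|t].
move=> [ce ca] [|[|t]] // lt; last first.
  by rewrite -addn1 addnC PoszD addrA; apply: (IH _ _ _ _ ca) => //; apply: ac.
move=> h; have [w|u uP] := (ce (h \o to_cycles cx i)).1.
  rewrite /= (_ : to_cycles cx i (f w) = 0) ?linear0 //.
  by apply: ker_incl_inj; rewrite linear0; apply/ex; exists w.
exists u => x; have [y <-] := ses_surj (acyclic_ses i ac) x.
exact/esym/uP.
Qed.

Lemma co_hom_acyclic_fromE cx J W k i (f : {linear W -> cx i}) :
  co_hom_acyclic_from J f (segment_tail cx k i) ->
  forall t, (t <= k)%N -> forall h : {linear J -> cycles cx (i + t%:Z + 1)},
    exists u : {linear J -> cx (i + t%:Z)}, forall x, to_cycles cx _ (u x) = h x.
Proof.
elim: k W i f => [|k IH] W i f.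
  move=> [_ h] [|t] //; rewrite addr0 => _ g; have [u uP] := h g; by exists u.
move=> [ce ca] [|t] lt; last first.
  by rewrite -addn1 addnC PoszD addrA; apply: (IH _ _ _ ca).
rewrite addr0 => h.
have [u uP] : exists u :
  {linear J -> cx i}, forall x,
  (cycles_incl cx (i + 1) \o h) x = cx_diff cx i (u x).
  (* Exactness at the next term is recorded in the rest of the string, whose head depends on k. *)
  case: k ca {IH lt} => [|k] /= [ca _];
    apply/(ca (cycles_incl cx (i + 1) \o h)) => x /=.
    apply: ker_incl_inj; rewrite linear0.
    exact: (ker_inclP (cx_diff cx (i + 1)) _).2 (ex_intro _ (h x) erefl).
  by apply/ker_inclP; exists (h x).
by exists u => x; apply: ker_incl_inj; rewrite -[LHS]uP.
Qed.

(** Total acyclicity is stated only for segments starting at multiples of n; this places every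
    degree in one of them. *)
Lemma int_segment (n : nat) (j : int) : (0 < n)%N ->
  exists (i : int) (t : nat), (t <= n.-1)%N /\ j = i * n%:Z + t%:Z.
Proof.
move=> n0; exists (j %/ n%:Z)%Z, `|(j %% n%:Z)%Z|%N.
have nz : n%:Z != 0 by rewrite eqz_nat -lt0n.
have ge : 0 <= (j %% n%:Z)%Z by apply: modz_ge0.
split; last by rewrite gez0_abs // -divz_eq.
rewrite -ltnS prednK // -ltz_nat gez0_abs //.
by have := ltz_mod j nz.
Qed.

End Complexes.

Lemma projective_regular (A : pzRingType) : projective (A^o : lmodType A).
Proof.
move=> M N f g sf; have [y yP] := sf (g 1).
by exists (scaler_map y) => x; rewrite /= linearZ /= yP -linearZ /= [_ *: _]mulr1.
Qed.

(** * Orthogonality and construction of n Z-Gorenstein objects *)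

Section GorensteinObjects.
Variables (R : comPzRingType) (A : algebra R) (artR : artinian R).
Variables (n : nat) (n_gt0 : (0 < n)%N) (C : lmodType A -> Prop).
Implicit Types G I J K M N P Q T X Y Z W : lmodType A.

(** The segments cover all degrees, so every map from cycles to Q extends to the term containing
    them. Hence Ext^1(Z^j, Q) = 0 for all j, and going left along the complex gives the higher
    Ext. *)
Lemma nZ_Gprj_ext G Q k : fgmod G -> nZ_Gprj n C G -> fgmod Q -> projective Q ->
  ext k G Q.
Proof.
move=> fG [_ [cx [i0 [[ac pcx hcx _] iG]]]] fQ pQ.
apply: (ext_iso_l artR fG iG).
have e j (h : {linear cycles cx j -> Q}) :
    exists u : {linear cx j -> Q}, forall x, u (cycles_incl cx j x) = h x.
  have [i [t [tn jE]]] := int_segment j n_gt0; subst j.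
  have [h0 ha] := hcx i Q fQ pQ.
  case: t tn h => [|t] tn h; last first.
    by apply: (contra_hom_acyclic_fromE ac _ ha) => // x; apply: ker_inclP.
  by rewrite addr0 in h *; have [u uP] := h0 h; exists u.
(* Writing j as j - 1 + 1 exhibits the cycles as the quotient in the sequence at degree j - 1. *)
move: (i0 * _) => j {i0 iG}; rewrite -[j](subrK 1).
elim: k j => [|k IH] j; last rewrite -[j - 1](subrK 1).
  exists (cycles cx (j - 1)), (cx (j - 1)), (cycles_incl cx _), (to_cycles cx _).
  by split; [case: (pcx (j - 1)) | exact: acyclic_ses | exact: e].
apply: ext_syz1_first (IH (j - 1)).
exists (cx (j - 1 - 1 + 1)), (cycles_incl cx _), (to_cycles cx _).
by split; [case: (pcx (j - 1 - 1 + 1)) | exact: acyclic_ses].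
Qed.

Lemma nZ_Ginj_ext G J k : nZ_Ginj n C G -> fgmod J -> injective_module J ->
  ext k J G.
Proof.
move=> [_ [cx [i0 [[ac icx hcx _] iG]]]] fJ iJ.
apply: (ext_iso_r (isomorphic_sym iG)).
have e j (h : {linear J -> cycles cx (j + 1)}) :
    exists u : {linear J -> cx j}, forall x, to_cycles cx j (u x) = h x.
  have [i [t [tn jE]]] := int_segment j n_gt0; subst j.
  have [_ ha] := hcx i J fJ iJ.
  exact: (co_hom_acyclic_fromE ha tn).
move: (i0 * _) => j {i0 iG}; elim: k j => [|k IH] j.
  apply: (ext1_of_lift (acyclic_ses j ac)); last exact: e.
  by apply: (ext_inj_r artR 0 fJ); case: (icx j).
apply: (ext_ses_sub artR fJ (acyclic_ses j ac)); first exact: IH.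
by apply: (ext_inj_r artR _ fJ); case: (icx j).
Qed.

Hypothesis Ciso : forall X Y, isomorphic X Y -> C X -> C Y.

Lemma nZ_Gprj_of_family (Z : int -> lmodType A) :
  (forall j, fsyz1 (Z (j + 1)) (Z j)) -> (forall j, gproj (Z j)) ->
  (forall j : int, C (Z (j * n%:Z))) -> nZ_Gprj n C (Z 0).
Proof.
move=> sZ gZ CZ; split; first by have := CZ 0; rewrite mul0r.
have [j|cx [ac pcx iZ]] := complex_of_family (Z := Z) (F :=
  fun P => fgmod P /\ projective P).
  by have [P [i [p [fP pP s]]]] := sZ j; exists P, i, p.
exists cx, 0; split; last by rewrite mul0r; apply: iZ.
split=> // [i Q fQ pQ|i]; last exact: Ciso (iZ _) (CZ i).
apply: contra_hom_acyclicI => // j; apply: (@ext_iso_l _ _ artR 0 _ (Z (j + 1))).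
- by apply: isomorphic_fg (iZ (j + 1)) _; case: (gZ (j + 1)).
- exact/isomorphic_sym/iZ.
- exact: (gproj_proj 0 (gZ (j + 1))).
Qed.

Lemma nZ_Ginj_of_family (Z : int -> lmodType A) :
  (forall j, exists I (i : {linear Z j -> I}) (p : {linear I -> Z (j + 1)}),
     (fgmod I /\ injective_module I) /\ ses i p) ->
  (forall j J, fgmod J -> injective_module J -> ext1 J (Z j)) ->
  (forall j : int, C (Z (j * n%:Z))) -> nZ_Ginj n C (Z 0).
Proof.
move=> sZ eZ CZ; split; first by have := CZ 0; rewrite mul0r.
have [cx [ac pcx iZ]] := complex_of_family (F :=
  fun I => fgmod I /\ injective_module I) sZ.
exists cx, 0; split; last by rewrite mul0r; apply: iZ.
split=> // [i J fJ iJ|i]; last exact: Ciso (iZ _) (CZ i).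
apply: co_hom_acyclicI => // j; apply: (@ext_iso_r _ 0 _ (Z j)); first exact: iZ.
exact: eZ.
Qed.

End GorensteinObjects.

(** * Passing to the dual class *)

Section Orthogonality.
Variables (R : comPzRingType) (A : algebra R) (artR : artinian R).
Variables (n : nat) (C : lmodType A -> Prop).
Implicit Types X Y T : lmodType A.

Definition left_orthogonal_closed : Prop := forall X, C X <->
  fgmod X /\ forall T, C T -> forall i, (i.+1 < n)%N -> ext i T X.

Definition right_orthogonal_closed : Prop := forall X, C X <->
  fgmod X /\ forall T, C T -> forall i, (i.+1 < n)%N -> ext i X T.

Definition nZ_orthogonal : Prop := forall X Y, C X -> C Y ->
  forall i, ~~ (n %| i.+1)%N -> ext i X Y.

Lemma nZ_cluster_tiltingE : nZ_cluster_tilting n C ->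
  [/\ contravariantly_finite C /\ covariantly_finite C, left_orthogonal_closed,
      right_orthogonal_closed & nZ_orthogonal].
Proof.
move=> [[fC CE2 CE3] CO]; have Cfg X : C X -> fgmod X by move=> /CE2[].
split=> // [X|X|X Y CX CY i ni]; last first.
- by apply/(Ext_vanishesP artR _ _ (Cfg _ CX))/CO.
- rewrite CE3; split=> -[fX h]; split=> // T CT.
    by move=> i lt; apply/(Ext_vanishesP artR _ _ fX)/h.
  by move=> [|i] // lt; apply/(Ext_vanishesP artR _ _ fX)/h.
- rewrite CE2; split=> -[fX h]; split=> // T CT.
    by move=> i lt; apply/(Ext_vanishesP artR _ _ (Cfg _ CT))/h.
  by move=> [|i] // lt; apply/(Ext_vanishesP artR _ _ (Cfg _ CT))/h.
Qed.

Lemma right_orthogonal_closed_iso X Y : right_orthogonal_closed ->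
  isomorphic X Y -> C X -> C Y.
Proof.
move=> CE iXY /CE[fX h]; have fY := isomorphic_fg iXY fX; apply/CE;
  split=> // T CT i lt.
by apply: (ext_iso_l artR fY (isomorphic_sym iXY)); apply: h.
Qed.

Lemma right_orthogonal_closed_proj P : right_orthogonal_closed ->
  fgmod P -> projective P -> C P.
Proof. by move=> CE fP pP; apply/CE; split=> // T _ i _; apply: ext_proj_l. Qed.

End Orthogonality.

Section Transfer.
Variables (R : comPzRingType) (E : lmodType R) (artR : artinian R).
Hypothesis mE : maximal_thin E.
Variables (A B : algebra R) (d : opposite A B).

Local Notation D := (Dmod (opp_am d) E).
Local Notation D' := (Dmod (opp_ma d) E).

Lemma DD'_iso (Y : lmodType B) : fgmod Y -> isomorphic Y (D (D' Y)).
Proof. exact: (ev_iso artR mE (opposite_sym d)). Qed.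

Lemma D'D_iso (X : lmodType A) : fgmod X -> isomorphic X (D' (D X)).
Proof. exact: (ev_iso artR mE d). Qed.

Lemma D_fg (X : lmodType A) : fgmod X -> fgmod (D X).
Proof. exact: Dmod_fg. Qed.

Lemma D'_fg (Y : lmodType B) : fgmod Y -> fgmod (D' Y).
Proof. exact: Dmod_fg. Qed.

Lemma ext_D' k (X Y : lmodType B) : fgmod X -> fgmod Y ->
  ext k X Y <-> ext k (D' Y) (D' X).
Proof.
move=> fX fY; rewrite (ext_dualE artR mE d k (D'_fg fY) fX).
split; first exact/ext_iso_r/DD'_iso.
by apply/ext_iso_r/isomorphic_sym/DD'_iso.
Qed.

Variables (n : nat) (C : lmodType A -> Prop).

Definition dual_class (Y : lmodType B) : Prop := fgmod Y /\ C (D' Y).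

Hypotheses (CE2 : left_orthogonal_closed n C) (CE3 : right_orthogonal_closed n C).
Hypothesis CO : nZ_orthogonal n C.

Let Ciso X Y : isomorphic X Y -> C X -> C Y.
Proof. exact: (right_orthogonal_closed_iso artR CE3). Qed.

Lemma dual_class_D X : C X -> dual_class (D X).
Proof.
move=> CX; have fX : fgmod X by case/CE2: CX.
by split; [exact: D_fg | exact: Ciso (D'D_iso fX) CX].
Qed.

Lemma dual_class_left : left_orthogonal_closed n dual_class.
Proof.
move=> Y; split=> [[fY CY]|[fY h]]; split=> //.
  move=> T [fT CT] i lt; apply/(ext_D' i fT fY).
  by case/CE3: CY => _; apply.
apply/CE3; split=> [|S CS i lt]; first exact: D'_fg.
have fS : fgmod S by case/CE3: CS.
apply: (ext_iso_r (isomorphic_sym (D'D_iso fS))); apply/(ext_D' i (D_fg fS) fY).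
exact: h (dual_class_D CS) i lt.
Qed.

Lemma dual_class_right : right_orthogonal_closed n dual_class.
Proof.
move=> Y; split=> [[fY CY]|[fY h]]; split=> //.
  move=> T [fT CT] i lt; apply/(ext_D' i fY fT).
  by case/CE2: CY => _; apply.
apply/CE2; split=> [|S CS i lt]; first exact: D'_fg.
have fS : fgmod S by case/CE3: CS.
apply: (ext_iso_l artR fS (D'D_iso fS)); apply/(ext_D' i fY (D_fg fS)).
exact: h (dual_class_D CS) i lt.
Qed.

Lemma dual_class_nZ : nZ_orthogonal n dual_class.
Proof. by move=> X Y [fX CX] [fY CY] i ni; apply/(ext_D' i fX fY)/CO. Qed.

(** The dual of a left approximation of D' Y, followed by the inverse of evaluation at Y, is a right
    approximation; factorisations are transposed by [flip]. *)
Lemma dual_class_contravariantly_finite :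
  covariantly_finite C -> contravariantly_finite dual_class.
Proof.
move=> cC Y fY; have [T [g [CT gP]]] := cC (D' Y) (D'_fg fY).
pose e : {linear Y -> D (D' Y)} := ev E (opposite_sym d) Y.
have ei : injective e by exact: (ev_inj mE (d := opposite_sym d)).
have [z|b bP] := @factor_inj _ _ _ _ e (idfun : {linear D (D' Y) -> D (D' Y)}) ei.
  exact: (ev_surj artR mE (d := opposite_sym d) fY).
exists (D T), (b \o Dmap (opp_am d) E g); split; first exact: dual_class_D.
move=> T' h [fT' CT']; have [u uP] := gP (D' T') (Dmap (opp_ma d) E h) CT'.
exists (flip (d := d) u) => t; apply: ei.
apply: etrans _ (esym (bP _)); apply: dual_ext => phi.
exact: (congr1 (fun k : D' T' => k t) (uP phi)).
Qed.

(** I is a summand of some D'(B^l), and Ext(D'(B^l), Y) vanishes together with Ext(D Y, B^l). *)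
Lemma pd_inj_of_id_regular :
  (exists m, forall k (Y : lmodType B), (m <= k)%N -> fgmod Y -> ext k Y B^o) ->
  exists m, forall k (I Y : lmodType A), (m <= k)%N ->
    fgmod I -> injective_module I -> fgmod Y -> ext k I Y.
Proof.
move=> [m hm]; exists m => k I Y mk fI iI fY.
have [l [i ii]] := cofree_embed artR mE d fI.
have [r rP] := injective_split iI ii.
apply: (ext_stable_retract artR fI (stable_retract_of_retract rP)).
apply: (ext_iso_r (isomorphic_sym (D'D_iso fY))).
apply/(ext_D' k (D_fg fY) (fgmod_rV B l))/ext_rV/hm => //; exact: D_fg.
Qed.

Lemma nZ_Ginj_of_gproj (K : lmodType A) : C K ->
  (exists m, forall k (I Y : lmodType B), (m <= k)%N ->
    fgmod I -> injective_module I -> fgmod Y -> ext k I Y) ->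
  gproj (D K) -> nZ_Ginj n C K.
Proof.
move=> CK pdB gK; have fK : fgmod K by case/CE2: CK.
have enoughB := enough_injectives_algebra artR mE (opposite_sym d).
have [Z [Z0 gZ sZ]] := gproj_family artR enoughB pdB gK.
have CZ := C_family artR dual_class_right dual_class_nZ _ gZ sZ.
have {}CZ j : C (D' (Z (- j * n%:Z))).
  by case: (CZ _ (- j)) => //; rewrite Z0; apply: dual_class_D.
suff : nZ_Ginj n C (D' (Z (- 0))).
  rewrite oppr0 Z0 => -[_ [cx [j [tcx iZ]]]]; split=> //; exists cx, j; split=> //.
  have [f [f' [fK' f'K]]] := isomorphic_inv (D'D_iso fK).
  have [g [g' [gK' g'K]]] := isomorphic_inv iZ.
  apply: (isomorphic_of_inv (f := g \o f) (g := f' \o g')) => x /=.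
    by rewrite gK' fK'.
  by rewrite f'K g'K.
(* D' reverses arrows, so the dual family is indexed by - j. *)
apply: (nZ_Ginj_of_family Ciso (Z := fun j => D' (Z (- j)))) => [j|j J fJ iJ|j].
- have e : - (j + 1) + 1 = - j by rewrite opprD subrK.
  have [P [i [p [fP pP s]]]] : fsyz1 (Z (- j)) (Z (- (j + 1)))
    by rewrite -[in Z (- j)]e.
  exists (D' P), (Dmap (opp_ma d) E p), (Dmap (opp_ma d) E i); split.
    split; first exact: D'_fg.
    exact: (Dmod_injective (maximal_thin_injective mE) (d := opposite_sym d) pP).
  exact: (Dses (maximal_thin_injective mE)).
(* J is a summand of D'(B^l), and Ext^1(D'(B^l), D' Z) corresponds to Ext^1(Z, B^l), which is 0 for
   Z orthogonal to projectives. *)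
- have [l [i ii]] := cofree_embed artR mE d fJ.
  have [r rP] := injective_split iJ ii.
  apply: (@ext_stable_retract _ _ artR 0 _ _ _ fJ (stable_retract_of_retract rP)).
  apply/(ext_D' 0 (gZ (- j)).1 (fgmod_rV B l)).
  exact: (gproj_proj 0 (gZ (- j)) (fgmod_rV B l) (@projective_rV _ _)).
- by rewrite -mulNr; apply: CZ.
Qed.

End Transfer.

(** * The two implications *)

Section Regular.
Variables (R : comPzRingType) (A : algebra R) (artR : artinian R).
Hypothesis enoughA : enough_injectives A.
Variables (n : nat) (C : lmodType A -> Prop).

Lemma finite_injective_dimension_regular : contravariantly_finite C ->
  left_orthogonal_closed n C -> right_orthogonal_closed n C ->
  (forall X, C X -> exists m, forall k, (m <= k)%N -> ext k X A^o) ->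
  finite_injective_dimension A^o.
Proof.
move=> cC CE2 CE3 hC; have fA := fgmod_regular A.
have Cfg X : C X -> fgmod X by case/CE2.
have CP m : C 'rV[A]_m.
  by apply: (right_orthogonal_closed_proj CE3);
    [exact: fgmod_rV | exact: projective_rV].
have [m hm] := ext_uniform_bound artR enoughA fA
  (ext_bound_of_C artR enoughA fA Cfg CP cC CE2 hC).
apply: (finite_injective_dimension_of_ext artR enoughA (d := m) fA) => Y fY.
exact: hm.
Qed.

End Regular.

Section Main.
Variables (R : comPzRingType) (E : lmodType R) (artR : artinian R).
Hypothesis mE : maximal_thin E.
Variables (A B : algebra R) (d : opposite A B).
Variables (n : nat) (n_gt0 : (0 < n)%N) (C : lmodType A -> Prop).

Let enoughA : enough_injectives A := enough_injectives_algebra artR mE d.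
Let enoughB : enough_injectives B :=
  enough_injectives_algebra artR mE (opposite_sym d).

Hypothesis hC : nZ_cluster_tilting n C.

Lemma Gprj_cluster_tilting_id :
  nZ_Gorenstein_projective_cluster_tilting n C -> finite_injective_dimension A^o.
Proof.
move=> [_ h]; have [[cC _] CE2 CE3 CO] := nZ_cluster_tiltingE artR hC.
apply: (finite_injective_dimension_regular artR enoughA cC CE2 CE3) => X CX.
have fX : fgmod X by case/CE2: CX.
have [i [K [sK gK]]] := h X CX; have [fK e] := is_syzygy_ext artR sK fX.
exists (i * n)%N => k /subnKC <-; apply/e.
apply: (nZ_Gprj_ext artR n_gt0 _ fK gK); first exact: fgmod_regular.
exact: projective_regular.
Qed.

(** For Y in the dual class, Ext(Y, B) corresponds to Ext(D' B, D' Y) with D' B injective; passing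
    to a cosyzygy of D' Y that is n Z-Gorenstein injective bounds it. *)
Lemma Ginj_cluster_tilting_id :
  nZ_Gorenstein_injective_cluster_tilting n C -> finite_injective_dimension B^o.
Proof.
move=> [_ h]; have [[_ cC] CE2 CE3 CO] := nZ_cluster_tiltingE artR hC.
apply: (@finite_injective_dimension_regular _ _ artR enoughB n (dual_class E d C)).
- exact: (dual_class_contravariantly_finite artR mE d CE2 CE3 cC).
- exact: (dual_class_left artR mE d CE2 CE3).
- exact: (dual_class_right artR mE d CE2 CE3).
move=> Y [fY CY]; have fX := D'_fg artR mE d fY.
have [i [K [sK gK]]] := h _ CY; have [fK e] := is_cosyzygy_ext artR sK fX.
exists (i * n)%N => k /subnKC <-.
have fB : fgmod (B^o : lmodType B) := fgmod_regular B.
have fDB := D'_fg artR mE d fB.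
apply/(ext_D' artR mE d _ fY fB)/(e _ _ fDB).
apply: (nZ_Ginj_ext artR n_gt0 _ gK fDB).
exact: (Dmod_injective (maximal_thin_injective mE) (d :=
  opposite_sym d) (@projective_regular B)).
Qed.

Lemma Gprj_cluster_tilting_of_id :
  finite_injective_dimension A^o -> finite_injective_dimension B^o ->
  nZ_Gorenstein_projective_cluster_tilting n C.
Proof.
move=> idA idB; split=> // X CX.
have [_ CE2 CE3 CO] := nZ_cluster_tiltingE artR hC.
have pdA := pd_inj_of_id_regular artR mE d (finite_injective_dimension_ext artR
  idB).
have [i [K [sK gK CK]]] := C_gproj_syzygy artR n_gt0 CE3 CO
  (finite_injective_dimension_ext artR idA) CX.
exists i, K; split=> //; have [Z [Z0 gZ sZ]] := gproj_family artR enoughA pdA gK.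
rewrite -Z0 in CK *.
apply: (nZ_Gprj_of_family artR _ sZ gZ (C_family artR CE3 CO CK gZ sZ)).
by move=> U V; apply: (right_orthogonal_closed_iso artR CE3).
Qed.

Lemma Ginj_cluster_tilting_of_id :
  finite_injective_dimension A^o -> finite_injective_dimension B^o ->
  nZ_Gorenstein_injective_cluster_tilting n C.
Proof.
move=> idA idB; split=> // X CX.
have [_ CE2 CE3 CO] := nZ_cluster_tiltingE artR hC.
have [m hm] := pd_inj_of_id_regular artR mE d (finite_injective_dimension_ext
  artR idB).
have pdB := pd_inj_of_id_regular artR mE (opposite_sym d)
  (finite_injective_dimension_ext artR idA).
have fX : fgmod X by case/CE2: CX.
have [K sK] := is_cosyzygy_ex artR enoughA (m * n) fX.
have [fK e] := is_cosyzygy_ext artR sK fX.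
have CK : C K.
  apply/CE2; split=> // T CT i lt; have fT : fgmod T by case/CE2: CT.
  apply/e/CO => //; rewrite -addnS dvdn_addr ?dvdn_mull // gtnNdvd //.
exists m, K; split=> //; apply: (nZ_Ginj_of_gproj artR mE CE2 CE3 CO CK pdB).
have fB : fgmod (B^o : lmodType B) := fgmod_regular B.
have fDB := D'_fg artR mE d fB.
split=> [|k]; first exact: D_fg.
(* Ext(D K, B) becomes Ext(D' B, K); shifting from K back to X raises the degree past the projective
   dimension of the injective D' B. *)
apply/(ext_D' artR mE d _ (D_fg artR mE d fK) fB).
apply: (ext_iso_r (D'D_iso artR mE d fK)); apply/(e _ _ fDB)/hm => //.
  by apply: leq_trans (leq_addr _ _); rewrite leq_pmulr.
exact: (Dmod_injective (maximal_thin_injective mE) (d :=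
  opposite_sym d) (@projective_regular B)).
Qed.

End Main.

(** * Left and right modules over an artin algebra as an opposite pair *)

Section ArtinAlgebraData.
Variables (R : comPzRingType) (L : pzRingType) (phi : {rmorphism R -> L}).
Hypothesis hL : artin_algebra phi.

Fact artin_algebra_central r (x : L) : phi r * x = x * phi r.
Proof. by case: hL => _ c _; apply: c. Qed.

Fact artin_algebra_fg : exists m (g : 'I_m -> L), forall x,
  exists c : 'I_m -> R, x = \sum_(i < m) phi (c i) * g i.
Proof. by case: hL. Qed.

Definition left_algebra : algebra R :=
    Algebra artin_algebra_central artin_algebra_fg.

Definition phi_op (r : R) : L^c := phi r.

Fact phi_op_zmod : zmod_morphism phi_op.
Proof. exact: (raddfB phi). Qed.

Fact phi_op_monoid : monoid_morphism phi_op.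
Proof.
split=> [|a b]; first exact: (rmorph1 phi).
by rewrite /phi_op rmorphM; apply: artin_algebra_central.
Qed.

Definition phi_op_rmorphism : {rmorphism R -> L^c} :=
  HB.pack phi_op (GRing.isZmodMorphism.Build R L^c phi_op phi_op_zmod)
    (GRing.isMonoidMorphism.Build R L^c phi_op phi_op_monoid).

Fact phi_op_central r (x : L^c) : phi_op_rmorphism r * x = x * phi_op_rmorphism r.
Proof. exact/esym/artin_algebra_central. Qed.

Fact phi_op_fg : exists m (g : 'I_m -> L^c), forall x, exists c : 'I_m -> R,
  x = \sum_(i < m) phi_op_rmorphism (c i) * g i.
Proof.
have [m [g gP]] := artin_algebra_fg; exists m, g => x; have [a ->] := gP x.
by exists a; apply: eq_bigr => i _; apply: artin_algebra_central.
Qed.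

Definition right_algebra : algebra R := Algebra phi_op_central phi_op_fg.

Definition right_left : antimorphism right_algebra left_algebra :=
  @Antimorphism R right_algebra left_algebra (fun x : L => x : L^c)
    (fun _ _ => erefl) (fun _ _ => erefl) erefl (fun _ => erefl).

Definition left_right : antimorphism left_algebra right_algebra :=
  @Antimorphism R left_algebra right_algebra (fun x : L^c => x : L)
    (fun _ _ => erefl) (fun _ _ => erefl) erefl (fun _ => erefl).

Definition right_left_opposite : opposite right_algebra left_algebra :=
  @Opposite R right_algebra left_algebra right_left left_right
    (fun _ => erefl) (fun _ => erefl).

End ArtinAlgebraData.

Theorem theorem3p7 (n : nat) (hn : (0 < n)%N)
    (R : comPzRingType) (L : pzRingType) (phi : {rmorphism R -> L})
    (hL : artin_algebra phi)
    (C : lmodType L^c -> Prop) (hC : nZ_cluster_tilting n C) :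
  nZ_Gorenstein_cluster_tilting n C <-> Gorenstein L.
Proof.
have artR : artinian R by case: hL.
have [E mE] := maximal_thin_ex artR.
pose d := right_left_opposite hL; split=> [[hp hi]|[idA idB]]; split.
- exact: (Gprj_cluster_tilting_id artR mE d hn hC hp).
- exact: (Ginj_cluster_tilting_id artR mE d hn hC hi).
- exact: (Gprj_cluster_tilting_of_id artR mE d hn hC idA idB).
- exact: (Ginj_cluster_tilting_of_id artR mE d hn hC idA idB).
Qed.
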